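(* Let $\mathfrak{C}$ and $\mathfrak{N} \subseteq \mathfrak{C}$ be the C$^*$-algebra and the subalgebra constructed in the context from $(\mathcal{H}_n)_{n \geq 1}$, $(A_n)_{n\geq 1}$, $(M_n)_{n\geq 1}$, $(\xi_n)_{n \geq 1}$. The subalgebra \[ C_0(0,1] \odot \mathfrak{N} := \left\{ \sum_{j=1}^m f_j \otimes N_j \;\middle|\; m \in \mathbb{N},\ N_j \in \mathfrak{N},\ f_j \in C_0(0,1] \right\} \] of $C_0(0,1] \otimes_{\min} \mathfrak{C}$ is (norm) dense and consists entirely of nilpotent operators.
   Context: Construction of $\mathfrak{C}$ and $\mathfrak{N}$. Fix finite dimensional Hilbert spaces $\mathcal{H}_n$ ($n \geq 1$), positive operators $A_n \in \mathcal{B}(\mathcal{H}_n)$ of norm one, and nilpotent operators $M_n \in \mathcal{B}(\mathcal{H}_n)$ such that $\sum_{n \geq 1} \|A_n - M_n\| < \infty$ (such a choice exists), and unit vectors $\xi_n \in \mathcal{H}_n$ with $A_n \xi_n = \xi_n$ for all $n$. For $n < m$ let $\phi_{n,m} : \bigotimes_{k=1}^n \mathcal{H}_k \to \bigotimes_{k=1}^m \mathcal{H}_k$ be the isometry $\phi_{n,m}(\eta_1 \otimes \cdots \otimes \eta_n) = \eta_1 \otimes \cdots \otimes \eta_n \otimes \xi_{n+1} \otimes \cdots \otimes \xi_m$. Let $\mathcal{K} = \bigotimes_{k=1}^\infty \mathcal{H}_k$ be the Hilbert space completion of the direct limit of the spaces $\bigotimes_{k=1}^n \mathcal{H}_k$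 along the maps $\phi_{n,m}$, with natural inclusions $\phi_n : \bigotimes_{k=1}^n \mathcal{H}_k \to \mathcal{K}$. Call a sequence $(S_n)_{n\geq 1}$ with $S_n \in \mathcal{B}(\mathcal{H}_n)$ admissible if $\prod_{n \geq 1} \max\{\|S_n\|, 1\} < \infty$ and $\sum_{n\geq 1} \|S_n \xi_n - \xi_n\| < \infty$. For an admissible sequence there is a unique bounded operator $\bigotimes_{n=1}^\infty S_n \in \mathcal{B}(\mathcal{K})$ satisfying $(\bigotimes_{n=1}^\infty S_n)(\phi_n \zeta) = \lim_{m \to \infty} \phi_m\big( (\bigotimes_{i=1}^m S_i)\, \phi_{n,m}(\zeta) \big)$ for all $n$ and all $\zeta \in \bigotimes_{k=1}^n \mathcal{H}_k$. Let $\mathcal{E}_A$ (respectively $\mathcal{E}_N$) be the set of all operators $\bigotimes_{n=1}^\infty S_n$ coming from admissible sequences for which there exists $k \in \mathbb{N}$ with $S_n = A_n$ (respectively $S_n = M_n$) for all $n \geq k$. Let $\mathfrak{C}$ be the C$^*$-subalgebra of $\mathcal{B}(\mathcal{K})$ generated by $\mathcal{E}_A$. Let $\mathfrak{N}$ be the (not necessarily closed nor self-adjoint) subalgebra of $\mathcal{B}(\mathcal{K})$ generated by $\mathcal{E}_N$; it is a dense subalgebra of $\mathfrak{C}$ all of whose elements are nilpotent. $C_0(0,1]$ is the C$^*$-algebra of continuous complex functions on $(0,1]$ vanishing at infinity (i.e. at $0$). *)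

(* Defs.v *)
From HB Require Import structures.
From mathcomp Require Import all_boot all_order all_algebra.
From mathcomp Require Import all_classical all_reals all_analysis.
From mathcomp Require Import complex.

Set Implicit Arguments.
Unset Strict Implicit.
Unset Printing Implicit Defensive.

Import Order.TTheory GRing.Theory Num.Theory.
Import numFieldNormedType.Exports.

Local Open Scope classical_set_scope.
Local Open Scope ring_scope.

(* A dot form is linear in its first argument and conjugate-linear in the
   second one. *)
HB.mixin Record CompleteNormedModule_isHilbert (R : realType) V
    of CompleteNormedModule R[i] V := {
  inner : {dot V for @Num.conj R[i]} ;
  inner_norm : forall x : V, inner x x = `|x| ^+ 2
}.

#[short(type="hilbertType")]
HB.structure Definition Hilbert (R : realType) :=
  {V of CompleteNormedModule_isHilbert R V & CompleteNormedModule R[i] V}.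

Notation "''[' x , y ]" := (inner x y) : ring_scope.

Section Operators.
Context {R : realType}.
Implicit Types V W : hilbertType R.

Definition bounded_op V W (T : V -> W) :=
  linear T /\ exists c : R[i], forall x, `|T x| <= c * `|x|.

(* Norms take their values in R[i]; they are real, hence the real part. *)
Definition opnorm V W (T : V -> W) : R :=
  sup [set complex.Re `|T x| | x in [set x | `|x| <= 1]].

Definition adjoint V (T T' : V -> V) := forall x y, '[T x, y] = '[x, T' y].

Definition positive_op V (T : V -> V) :=
  bounded_op T /\ forall x, 0 <= '[T x, x].

Definition nilpotent_op V (T : V -> V) := exists p, forall x, iter p T x = 0.

Definition isometric_op V W (T : V -> W) :=
  linear T /\ forall x, `|T x| = `|x|.

Definition lin_span V (A : set V) : set V :=
  [set x | exists m (c : 'I_m -> R[i]) (v : 'I_m -> V),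
     (forall i, A (v i)) /\ x = \sum_i c i *: v i].

Definition finite_dimensional V :=
  exists m (e : 'I_m -> V), lin_span (range e) = setT.

(* Closure in B(V) for the operator norm, of a set A of bounded operators. *)
Definition norm_closure V (A : set (V -> V)) : set (V -> V) :=
  [set T | bounded_op T /\
     forall e : R, 0 < e -> exists2 U, A U & opnorm (T - U) < e].

(* Subalgebras of B(V) are not required to be unital. *)
Definition subalgebra V (A : set (V -> V)) :=
  [/\ forall T, A T -> bounded_op T,
      A 0,
      forall (a : R[i]) T U, A T -> A U -> A (a *: T + U)
    & forall T U, A T -> A U -> A (T \o U)].

Definition cstar_subalgebra V (A : set (V -> V)) :=
  [/\ subalgebra A,
      forall T T', A T -> bounded_op T' -> adjoint T T' -> A T'
    & norm_closure A `<=` A].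

End Operators.

(* Hilbert space tensor products are described, up to a unique unitary, by
   the inner products of the elementary tensors and the density of their
   span; multilinearity of [t] follows from the former. *)
Section TensorProducts.
Context {R : realType}.

Definition is_tensor (I : finType) (V : I -> hilbertType R) (T : hilbertType R)
    (t : (forall i, V i) -> T) :=
  (forall x y, '[t x, t y] = \prod_i '[x i, y i]) /\
  closure (lin_span (range t)) = setT.

Definition is_tensor2 (V W T : hilbertType R) (t : V -> W -> T) :=
  (forall x x' y y', '[t x y, t x' y'] = '[x, x'] * '[y, y']) /\
  closure (lin_span [set z | exists x y, z = t x y]) = setT.

(* U is the operator F (x) G *)
Definition is_tensor2_op (V W T : hilbertType R) (t : V -> W -> T)
    (F : V -> V) (G : W -> W) (U : T -> T) :=
  bounded_op U /\ forall x y, U (t x y) = t (F x) (G y).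

(* the algebraic tensor product of A and B, acting on T *)
Definition odot (V W T : hilbertType R) (t : V -> W -> T)
    (A : set (V -> V)) (B : set (W -> W)) : set (T -> T) :=
  [set X | exists m (F : 'I_m -> V -> V) (G : 'I_m -> W -> W)
       (U : 'I_m -> T -> T),
     (forall j, [/\ A (F j), B (G j) & is_tensor2_op t (F j) (G j) (U j)]) /\
     X = \sum_j U j].

(* the minimal (i.e. spatial) tensor product of two C*-algebras of operators *)
Definition min_tensor (V W T : hilbertType R) (t : V -> W -> T)
    (A : set (V -> V)) (B : set (W -> W)) : set (T -> T) :=
  norm_closure (odot t A B).

End TensorProducts.

(* The infinite tensor product of the H n along the unit vectors xi n.
   Indices start at 0: [fin_tensor n] is the tensor product of
   H 0, ..., H n.-1, and [fin_tensor 0] is one-dimensional. *)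
Record infinite_tensor (R : realType) (H : nat -> hilbertType R)
    (xi : forall n, H n) := InfiniteTensor {
  fin_tensor : nat -> hilbertType R ;
  elem : forall n, (forall k : 'I_n, H k) -> fin_tensor n ;
  elemP : forall n, is_tensor (@elem n) ;
  conn : forall n m, fin_tensor n -> fin_tensor m ;
  conn_isometric : forall n m, (n <= m)%N -> isometric_op (@conn n m) ;
  conn_elem : forall n m, (n <= m)%N -> forall eta : forall k, H k,
    @conn n m (elem (fun k : 'I_n => eta k)) =
    elem (fun k : 'I_m => if (k < n)%N then eta k else xi k) ;
  lim_tensor : hilbertType R ;
  embed : forall n, fin_tensor n -> lim_tensor ;
  embed_isometric : forall n, isometric_op (@embed n) ;
  embed_conn : forall n m, (n <= m)%N ->
    forall z, embed (@conn n m z) = embed z ;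
  embed_dense : closure (\bigcup_n range (@embed n)) = setT
}.

Section Construction.
Context {R : realType} (H : nat -> hilbertType R) (xi : forall n, H n).
Context (X : infinite_tensor xi).
Implicit Types S B : forall n, H n -> H n.

Definition admissible S :=
  [/\ forall n, bounded_op (S n),
      cvgn (fun N => \prod_(n < N) Num.max (opnorm (S n)) 1)
    & cvgn (series (fun n => complex.Re `|S n (xi n) - xi n|))].

Definition is_fin_tensor_op S n (F : fin_tensor X n -> fin_tensor X n) :=
  bounded_op F /\
  forall eta : forall k : 'I_n, H k,
    F (elem X eta) = elem X (fun k => S k (eta k)).

Definition is_inf_tensor_op S (T : lim_tensor X -> lim_tensor X) :=
  bounded_op T /\
  exists F : forall m, fin_tensor X m -> fin_tensor X m,
    (forall m, is_fin_tensor_op S (F m)) /\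
    forall n (z : fin_tensor X n),
      embed (F m (conn m z)) @[m --> \oo] --> T (embed z).

Definition eventually_tensor B : set (lim_tensor X -> lim_tensor X) :=
  [set T | exists S, [/\ admissible S,
     exists k, forall n, (k <= n)%N -> S n = B n & is_inf_tensor_op S T]].

Definition frakC A :=
  smallest (@cstar_subalgebra R (lim_tensor X)) (eventually_tensor A).

Definition frakN M :=
  smallest (@subalgebra R (lim_tensor X)) (eventually_tensor M).

End Construction.

Arguments frakC {R H xi} X A.
Arguments frakN {R H xi} X M.

Section ContinuousFunctions.
Context {R : realType}.

(* C_0(0,1]; the values of f outside of ]0, 1] are irrelevant *)
Definition C0_01 : set (R -> R[i]) :=
  [set f | {within `]0%R, 1%R], continuous (f : R -> R[i]^o)} /\
           (f : R -> R[i]^o) x @[x --> 0^'+] --> (0 : R[i]^o)].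

Definition C0_01_faithful_rep (L : hilbertType R)
    (rho : (R -> R[i]) -> L -> L) :=
  [/\ forall f, C0_01 f -> bounded_op (rho f),
      forall (a : R[i]) f g, C0_01 f -> C0_01 g ->
        rho (fun x => a * f x + g x) = a *: rho f + rho g,
      forall f g, C0_01 f -> C0_01 g -> rho (fun x => f x * g x) = rho f \o rho g,
      forall f, C0_01 f -> adjoint (rho f) (rho (fun x => Num.conj (f x)))
    & forall f g, C0_01 f -> C0_01 g ->
        rho f = rho g <-> {in `]0, 1], f =1 g}].

End ContinuousFunctions.

(* Main.v *)
Require Import Defs.
From mathcomp Require Import all_boot all_order all_algebra.
From mathcomp Require Import all_classical all_reals all_analysis.
From mathcomp Require Import complex.
From mathcomp Require Import ring lra.
Import Order.TTheory GRing.Theory Num.Theory.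
Import numFieldNormedType.Exports.
Local Open Scope classical_set_scope.
Local Open Scope ring_scope.
Set Implicit Arguments.
Unset Strict Implicit.
Unset Printing Implicit Defensive.

(** The members of [frakN X M] are nilpotent for a reason that survives
    tensoring with any algebra.  Finitely many generators are infinite tensor
    products that all have the factor [M n] at every position [n] from some
    [k] on.  A word of length [q] in them therefore has a power of [M k] with
    exponent at least [q] at the position [k], and it vanishes once
    [M k ^ q = 0].  Expanding the [q]-th power of [\sum_j f_j (x) N_j] into
    words, the second tensor factor of every term is such a word, or a
    combination of such words ([power_tail_nilpotent], [odot_nilpotent]).

    Density rests on one estimate.  Replacing factors of a tensor product one
    at a time costs at most the sum of their distances, times a bound on the
    partial products of the norms ([tensor_op_dist], [inf_op_dist]).  Call a
    sequence [S] summably close to [A] when [\sum_n |S n - A n|] converges.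
    For such a sequence the tensor product exists, since [A n] fixes [xi n]
    ([close_inf_op]), and if [B] and [B'] are two of them, then every tensor
    product with tail [B] is a norm limit of tensor products with tail [B']
    ([close_approx]): keep the first factors, and change the far ones.  With
    [B = M] and [B' = A] this gives [frakN X M `<=` frakC X A].  Exchanging
    the two puts the generators of [frakC X A] into the closure of
    [frakN X M].  That closure is a C*-algebra: the adjoint of a tensor
    product with tail [M] has the tail [M^*], which is also summably close to
    [A], because [A] is self-adjoint, so it is a limit of tensor products
    with tail [M] ([eventually_adjoint]).  Hence [frakC X A] is contained in
    the closure ([frakC_sub_closure]), and [|F (x) G| <= |F| |G|] carries the
    approximation over to [P] ([odot_approx]).

    Tensor products of operators have to be constructed, as only the inner
    products of elementary tensors are given.  That [S] acting on one factor
    is bounded by [|S|] is the Schur product theorem ([gram_le]), which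
    Gram-Schmidt orthogonalization in the other factors reduces to a sum of
    squares; extension by continuity ([extend_op]) does the rest. *)

(** * Real-valued norms and inner products *)

Section Norm.
Context {R : realType}.
Implicit Types (V W : hilbertType R) (a b : R[i]).

Definition cabs a : R := complex.Re `|a|.

(** The norm of a Hilbert space takes its values in [R[i]], whose order is
    partial.  Estimates are made with its real part, to which nothing is
    lost. *)
Definition nrm V (x : V) : R := complex.Re `|x|.

Lemma cabsE a : `|a| = (cabs a)%:C%C.
Proof. by rewrite /cabs RRe_real // ger0_real. Qed.

Lemma cabs_ge0 a : 0 <= cabs a.
Proof. by rewrite -ler0c -cabsE. Qed.

Lemma ler_cabsD a b : cabs (a + b) <= cabs a + cabs b.
Proof. by rewrite -lecR rmorphD /= -!cabsE ler_normD. Qed.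

Lemma cabs0 : cabs 0 = 0.
Proof. by rewrite /cabs normr0. Qed.

Lemma cabs_eq0 a : cabs a <= 0 -> a = 0.
Proof. by rewrite -lecR -cabsE normr_le0 => /eqP. Qed.

Lemma nrmE V (x : V) : `|x| = (nrm x)%:C%C.
Proof. by rewrite /nrm RRe_real // ger0_real. Qed.

Lemma nrm_ge0 V (x : V) : 0 <= nrm x.
Proof. by rewrite -ler0c -nrmE. Qed.

Lemma ler_nrmD V (x y : V) : nrm (x + y) <= nrm x + nrm y.
Proof. by rewrite -lecR rmorphD /= -!nrmE ler_normD. Qed.

Lemma nrm0 V : nrm (0 : V) = 0.
Proof. by rewrite /nrm normr0. Qed.

Lemma nrmN V (x : V) : nrm (- x) = nrm x.
Proof. by rewrite /nrm normrN. Qed.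

Lemma nrmBC V (x y : V) : nrm (x - y) = nrm (y - x).
Proof. by rewrite -opprB nrmN. Qed.

Lemma ler_nrmB V (x y : V) : nrm (x - y) <= nrm x + nrm y.
Proof. by rewrite -(nrmN y) ler_nrmD. Qed.

Lemma nrm_le0 V (x : V) : nrm x <= 0 -> x = 0.
Proof. by rewrite -lecR -nrmE normr_le0 => /eqP. Qed.

Lemma nrmZ V a (x : V) : nrm (a *: x) = cabs a * nrm x.
Proof. by apply: complexI; rewrite rmorphM /= -nrmE -cabsE -nrmE normrZ. Qed.

Lemma cabsR (r : R) : 0 <= r -> cabs r%:C%C = r.
Proof. by move=> r0; rewrite /cabs ger0_norm ?ler0c. Qed.

Lemma ler_dist3 V (x y z : V) : nrm (x - z) <= nrm (x - y) + nrm (y - z).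
Proof. by rewrite -[x in x - z](subrK y) -addrA ler_nrmD. Qed.

Lemma nrm1P V (x : V) : `|x| = 1 -> nrm x = 1.
Proof. by rewrite /nrm => ->. Qed.

Lemma innerDl V (x y z : V) : '[x + y, z] = '[x, z] + '[y, z].
Proof. exact: linearDl. Qed.
Lemma innerDr V (x y z : V) : '[z, x + y] = '[z, x] + '[z, y].
Proof. exact: linearDr. Qed.
Lemma innerZl V a (x z : V) : '[a *: x, z] = a * '[x, z].
Proof. exact: linearZl_LR. Qed.
Lemma innerZr V a (x z : V) : '[z, a *: x] = Num.conj a * '[z, x].
Proof. exact: linearZr_LR. Qed.
Lemma inner0l V (z : V) : '[0, z] = 0.
Proof. exact: linear0l. Qed.
Lemma inner0r V (z : V) : '[z, 0] = 0.
Proof. exact: linear0r. Qed.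
Lemma innerBl V (x y z : V) : '[x - y, z] = '[x, z] - '[y, z].
Proof. exact: linearBl. Qed.
Lemma innerBr V (x y z : V) : '[z, x - y] = '[z, x] - '[z, y].
Proof. exact: linearBr. Qed.

Lemma innerC V (x y : V) : '[x, y] = Num.conj '[y, x].
Proof. by rewrite hermC /= mul1r. Qed.

Lemma inner_suml V I (r : seq I) (F : I -> V) z :
  '[\sum_(i <- r) F i, z] = \sum_(i <- r) '[F i, z].
Proof.
elim: r => [|i r ih]; first by rewrite !big_nil inner0l.
by rewrite !big_cons innerDl ih.
Qed.

Lemma inner_sumr V I (r : seq I) (F : I -> V) z :
  '[z, \sum_(i <- r) F i] = \sum_(i <- r) '[z, F i].
Proof.
elim: r => [|i r ih]; first by rewrite !big_nil inner0r.
by rewrite !big_cons innerDr ih.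
Qed.

Lemma innerE V (x : V) : '[x, x] = (nrm x ^+ 2)%:C%C.
Proof. by rewrite inner_norm nrmE rmorphXn. Qed.

Lemma inner_eq0 V (x : V) : '[x, x] = 0 -> x = 0.
Proof.
rewrite innerE => /complexI /eqP; rewrite sqrf_eq0 => /eqP n0.
by apply: nrm_le0; rewrite n0.
Qed.

Lemma cauchy_schwarz V (x y : V) : cabs '[x, y] <= nrm x * nrm y.
Proof.
have [->|y0] := eqVneq y 0; first by rewrite inner0r cabs0 nrm0 mulr0.
have yy0 : '[y, y] != 0 by apply: contra y0 => /eqP /inner_eq0 ->.
pose a := '[x, y] / '[y, y].
have cyy : Num.conj '[y, y] = '[y, y] by rewrite -innerC.
have : 0 <= '[x - a *: y, x - a *: y] by rewrite innerE ler0c sqr_ge0.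
have -> : '[x - a *: y, x - a *: y] =
    '[x, x] - `|'[x, y]| ^+ 2 / '[y, y].
  rewrite innerBl !innerBr !innerZl !innerZr /a fmorph_div /= cyy.
  by rewrite (innerC y x) normCK; field.
rewrite subr_ge0 ler_pdivrMr; last by rewrite lt0r yy0 innerE ler0c sqr_ge0.
rewrite !innerE cabsE -!rmorphXn -rmorphM /= lecR -exprMn.
by rewrite ler_sqr // nnegrE ?cabs_ge0 // mulr_ge0 ?nrm_ge0.
Qed.

End Norm.
#[global] Hint Extern 0 (is_true (0 <= nrm _)) => solve [exact: nrm_ge0] : core.
#[global] Hint Extern 0 (is_true (0 <= cabs _)) => solve [exact: cabs_ge0] : core.

Section Limits.
Context {R : realType}.
Implicit Types (V : hilbertType R).

Lemma ltr0c (r : R) : (0 < r%:C%C :> R[i]) = (0 < r).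
Proof. exact: ltcR 0 r. Qed.

Lemma cvg_nrmP V (u : nat -> V) (l : V) :
  u @ \oo --> l <->
  forall e : R, 0 < e -> exists N, forall n, (N <= n)%N -> nrm (u n - l) < e.
Proof.
split=> [/cvgrPdist_lt ul e e0|ul].
  have [|N _ hN] := ul e%:C%C; first by rewrite ltr0c.
  exists N => n /hN /=; rewrite nrmE ltcR /= => h.
  by rewrite nrmBC.
apply/cvgrPdist_lt => e e0.
have ee : e = (complex.Re e)%:C%C by rewrite RRe_real // gtr0_real.
have [|N hN] := ul (complex.Re e); first by rewrite -ltr0c -ee.
exists N => // n /= /hN h.
by rewrite ee nrmE ltcR nrmBC.
Qed.

Lemma cauchy_lim V (u : nat -> V) :
  (forall e : R, 0 < e -> exists N, forall m n, (N <= m)%N -> (N <= n)%N ->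
     nrm (u m - u n) < e) -> exists l : V, u @ \oo --> l.
Proof.
move=> hu; apply/cvg_ex/cauchy_cvgP/cauchy_exP => e e0.
have ee : e = (complex.Re e)%:C%C by rewrite RRe_real // gtr0_real.
have [|N hN] := hu (complex.Re e); first by rewrite -ltr0c -ee.
exists (u N); exists N => // n /= Nn.
by rewrite -ball_normE /= nrmE ee ltcR hN.
Qed.

Lemma cvg_nrm_le V (u : nat -> V) (l : V) (c : R) N :
  u @ \oo --> l -> (forall n, (N <= n)%N -> nrm (u n) <= c) -> nrm l <= c.
Proof.
move=> /cvg_nrmP ul uc; apply/ler_addgt0Pl => e /ul[N' hN'].
have lt1 := hN' (maxn N N') (leq_maxr _ _).
have le2 := uc (maxn N N') (leq_maxl _ _).
have le3 := ler_nrmB (u (maxn N N')) (u (maxn N N') - l).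
by rewrite subKr in le3; lra.
Qed.

Definition dense_in V (D : set V) :=
  forall x (e : R), 0 < e -> exists2 y, D y & nrm (x - y) < e.

Lemma closure_dense V (D : set V) : closure D = setT -> dense_in D.
Proof.
move=> clD x e e0.
have : closure D x by rewrite clD.
have e0' : 0 < e%:C%C :> R[i] by rewrite ltr0c.
move=> /(_ _ (nbhsx_ballx x _ e0'))[y [Dy]].
by rewrite -ball_normE /= nrmE ltcR => xy; exists y.
Qed.

End Limits.

(** * Bounded operators *)

Section Bounded.
Context {R : realType}.
Implicit Types (V W Z : hilbertType R) (a : R[i]) (c d : R).

Definition bop c V W (T : V -> W) :=
  linear T /\ forall x, nrm (T x) <= c * nrm x.

Lemma lin0 V W (T : V -> W) : linear T -> T 0 = 0.
Proof.
move=> lT; have := lT 1 0 0; rewrite !scale1r addr0 => /eqP.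
by rewrite -subr_eq subrr eq_sym => /eqP.
Qed.

Lemma linZ V W (T : V -> W) : linear T -> forall a x, T (a *: x) = a *: T x.
Proof. by move=> lT a x; rewrite -[a *: x]addr0 lT (lin0 lT) addr0. Qed.

Lemma linD V W (T : V -> W) : linear T -> forall x y, T (x + y) = T x + T y.
Proof. by move=> lT x y; rewrite -[x]scale1r lT !scale1r. Qed.

Lemma linB V W (T : V -> W) : linear T -> forall x y, T (x - y) = T x - T y.
Proof. by move=> lT x y; rewrite (linD lT) -scaleN1r (linZ lT) scaleN1r. Qed.

Lemma lin_sum V W (T : V -> W) : linear T -> forall I (r : seq I) (F : I -> V),
  T (\sum_(i <- r) F i) = \sum_(i <- r) T (F i).
Proof.
move=> lT I r F; elim: r => [|i r ih]; first by rewrite !big_nil (lin0 lT).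
by rewrite !big_cons (linD lT) ih.
Qed.

Lemma bounded_opP V W (T : V -> W) :
  bounded_op T <-> exists2 c, 0 <= c & bop c T.
Proof.
split=> [[lT [c hc]]|[c c0 [lT hc]]].
  exists (cabs c) => //; split=> // x.
  have : `|T x| <= `|c| * `|x|.
    rewrite (le_trans (real_ler_norm _)) ?ger0_real //.
    rewrite -[X in _ * X]ger0_norm // -normrM [`| `|_| |]ger0_norm //.
    rewrite (le_trans (hc x)) // real_ler_norm //.
    by rewrite ger0_real // (le_trans _ (hc x)).
  by rewrite !nrmE cabsE -rmorphM /= lecR.
split=> //; exists c%:C%C => x.
by rewrite !nrmE -rmorphM /= lecR.
Qed.

Lemma bop_bounded c V W (T : V -> W) : 0 <= c -> bop c T -> bounded_op T.
Proof. by move=> c0 hT; apply/bounded_opP; exists c. Qed.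

Lemma le_opnorm V W (T : V -> W) x :
  bounded_op T -> `|x| <= 1 -> nrm (T x) <= opnorm T.
Proof.
move=> /bounded_opP[c c0 [_ hc]] x1; apply: ub_le_sup; last by exists x.
exists c => _ [y /= y1 <-]; rewrite (le_trans (hc y)) //.
by rewrite ler_piMr // -lecR -nrmE.
Qed.

Lemma opnorm_bop V W (T : V -> W) : bounded_op T -> bop (opnorm T) T.
Proof.
move=> bT; have [c c0 [lT hc]] := proj1 (bounded_opP T) bT; split=> // x.
have [x0|x0] := eqVneq (nrm x) 0.
  by rewrite x0 mulr0 -(mulr0 c) -x0.
have xp : 0 < nrm x by rewrite lt0r x0 nrm_ge0.
rewrite -ler_pdivrMr //.
have -> : nrm (T x) / nrm x = nrm (T ((nrm x)^-1%:C%C *: x)).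
  by rewrite (linZ lT) nrmZ cabsR ?invr_ge0 // mulrC.
by apply: le_opnorm => //; rewrite nrmE nrmZ cabsR ?invr_ge0 // mulVf.
Qed.

Lemma opnorm_ge0 V W (T : V -> W) : bounded_op T -> 0 <= opnorm T.
Proof.
by move=> bT; rewrite (le_trans (nrm_ge0 (T 0))) // le_opnorm // normr0.
Qed.

Lemma opnorm_le c V W (T : V -> W) : 0 <= c -> bop c T -> opnorm T <= c.
Proof.
move=> c0 [lT hc]; apply: ge_sup.
  by exists (complex.Re `|T 0|), 0 => //=; rewrite normr0.
move=> _ [y /= y1 <-]; rewrite (le_trans (hc y)) //.
by rewrite ler_piMr // -lecR -nrmE.
Qed.

Lemma bopW c d V W (T : V -> W) : c <= d -> bop c T -> bop d T.
Proof.
move=> cd [lT hc]; split=> // x; rewrite (le_trans (hc x)) //.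
by rewrite ler_wpM2r.
Qed.

Lemma bop_comp c d V W Z (S : W -> Z) (T : V -> W) :
  0 <= c -> bop c S -> bop d T -> bop (c * d) (S \o T).
Proof.
move=> c0 [lS hS] [lT hT]; split=> [a x y|x] /=; first by rewrite lT lS.
by rewrite (le_trans (hS _)) // -mulrA ler_wpM2l.
Qed.

Lemma bop_lin c d a V W (S T : V -> W) :
  bop c S -> bop d T -> bop (cabs a * c + d) (a *: S + T).
Proof.
move=> [lS hS] [lT hT].
have E x : (a *: S + T) x = a *: S x + T x by [].
split=> [b x y|x]; rewrite !E.
  rewrite lS lT !scalerDr !scalerA (mulrC a) -!addrA; congr (_ + _).
  by rewrite addrCA.
rewrite (le_trans (ler_nrmD _ _)) // mulrDl lerD //.
by rewrite nrmZ -mulrA ler_wpM2l.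
Qed.

Lemma cabsN1 : cabs (-1 : R[i]) = 1.
Proof. by rewrite /cabs normrN normr1. Qed.

Lemma bop0 V W : bop 0 (0 : V -> W).
Proof.
by split=> [a x y|x]; rewrite /0%R /= ?scaler0 ?addr0 // nrm0 mul0r.
Qed.

Lemma bop_id V : bop 1 (@id V).
Proof. by split=> // x; rewrite mul1r. Qed.

Lemma bounded_comp V W Z (S : W -> Z) (T : V -> W) :
  bounded_op S -> bounded_op T -> bounded_op (S \o T).
Proof.
move=> /bounded_opP[c c0 hS] /bounded_opP[d d0 hT].
by apply: (bop_bounded (mulr_ge0 c0 d0)); apply: bop_comp.
Qed.

Lemma bounded_lin a V W (S T : V -> W) :
  bounded_op S -> bounded_op T -> bounded_op (a *: S + T).
Proof.
move=> /bounded_opP[c c0 hS] /bounded_opP[d d0 hT].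
by apply: bop_bounded (bop_lin a hS hT); rewrite addr_ge0 // mulr_ge0.
Qed.

Lemma boundedB V W (S T : V -> W) :
  bounded_op S -> bounded_op T -> bounded_op (S - T).
Proof.
move=> hS hT; have := bounded_lin (-1) hT hS.
by rewrite scaleN1r addrC.
Qed.

Lemma bounded0 V W : bounded_op (0 : V -> W).
Proof. exact: bop_bounded (lexx 0) (bop0 V W). Qed.

Lemma opnormD V W (S T : V -> W) :
  bounded_op S -> bounded_op T -> opnorm (S + T) <= opnorm S + opnorm T.
Proof.
move=> hS hT; apply: opnorm_le; first by rewrite addr_ge0 ?opnorm_ge0.
have := bop_lin 1 (opnorm_bop hS) (opnorm_bop hT).
by rewrite scale1r /cabs normr1 mul1r.
Qed.

Lemma opnormBB V W (T : V -> W) : opnorm (T - T) <= 0.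
Proof. by apply: opnorm_le => //; rewrite subrr; apply: bop0. Qed.

Lemma opnormBC V W (S T : V -> W) :
  bounded_op S -> bounded_op T -> opnorm (S - T) = opnorm (T - S).
Proof.
have opN : forall U : V -> W, bounded_op U -> opnorm (- U) <= opnorm U.
  move=> U hU; apply: opnorm_le; first exact: opnorm_ge0.
  have := bop_lin (-1) (opnorm_bop hU) (bop0 V W).
  by rewrite cabsN1 mul1r addr0 scaleN1r addr0.
move=> hS hT; apply/eqP; rewrite eq_le -{1}opprB opN /=; last exact: boundedB.
by rewrite -{1}(opprB S T) opN //; exact: boundedB.
Qed.

Lemma opnorm_dist3 V W (S T U : V -> W) :
  bounded_op S -> bounded_op T -> bounded_op U ->
  opnorm (S - U) <= opnorm (S - T) + opnorm (T - U).
Proof.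
move=> hS hT hU; rewrite -[x in x - U](subrK T) -addrA.
by apply: opnormD; apply: boundedB.
Qed.

Lemma bop_dense c d V W (T : V -> W) (D : set V) :
  0 <= c -> 0 <= d -> bop d T -> dense_in D ->
  (forall x, D x -> nrm (T x) <= c * nrm x) -> bop c T.
Proof.
move=> c0 d0 [lT hT] dD hD; split=> // x; apply/ler_addgt0Pl => e e0.
pose e' := e / (1 + c + d).
have cd0 : 0 < 1 + c + d by lra.
have e'0 : 0 < e' by rewrite divr_gt0.
have [y Dy xy] := dD x e' e'0.
have h1 : nrm (T x) <= nrm (T (x - y)) + nrm (T y).
  by have := ler_nrmD (T (x - y)) (T y); rewrite -(linD lT) subrK.
have h2 : nrm (T (x - y)) <= d * e'.
  by rewrite (le_trans (hT _)) // ler_wpM2l // ltW.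
have h3 : nrm y <= nrm x + e'.
  have := ler_nrmB x (x - y); rewrite subKr => h; lra.
have h4 : c * nrm y <= c * (nrm x + e') by rewrite ler_wpM2l.
have h5 := hD y Dy.
have h6 : e = e' + c * e' + d * e' by rewrite /e'; field; lra.
rewrite mulrDr in h4; lra.
Qed.

Lemma eq_dense V W (S T : V -> W) (D : set V) :
  bounded_op S -> bounded_op T -> dense_in D ->
  (forall x, D x -> S x = T x) -> S = T.
Proof.
move=> hS hT dD hD; apply/funext => x.
have /bounded_opP[d d0 hd] := boundedB hS hT.
have [|_ h0] := bop_dense (lexx 0) d0 hd dD.
  by move=> y /hD e; rewrite [(S - T) y](_ : _ = S y - T y) // e subrr nrm0 mul0r.
by apply/eqP; rewrite -subr_eq0; apply/eqP/nrm_le0; rewrite -(mul0r (nrm x)) h0.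
Qed.

(** Extension by continuity.  The operator is given by its graph over a dense
    subspace, so that no choice of representatives is to be made on the
    subspace and well-definedness is part of the estimate. *)
Lemma extend_op V W (G : V -> W -> Prop) c : 0 <= c ->
  (forall a x w y z, G x w -> G y z -> G (a *: x + y) (a *: w + z)) ->
  (forall x w, G x w -> nrm w <= c * nrm x) ->
  dense_in [set x | exists w, G x w] ->
  exists2 T : V -> W, bop c T & forall x w, G x w -> T x = w.
Proof.
move=> c0 Glin Gbd Gd.
pose L x l := forall e : R, 0 < e -> exists y w,
  [/\ G y w, nrm (x - y) < e & nrm (l - w) < e].
have GL x w : G x w -> L x w.
  by move=> g e e0; exists x, w; rewrite !subrr !nrm0.
have Llin a x l y m : L x l -> L y m -> L (a *: x + y) (a *: l + m).
  move=> Lx Ly e e0; pose e' := e / (1 + cabs a).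
  have a0 : 0 < 1 + cabs a by rewrite ltr_wpDr.
  have e'0 : 0 < e' by rewrite divr_gt0.
  have [x1 [w1 [g1 x1e w1e]]] := Lx _ e'0.
  have [x2 [w2 [g2 x2e w2e]]] := Ly _ e'0.
  have near2 (Y : hilbertType R) (u v u1 v1 : Y) : nrm (u - u1) < e' ->
      nrm (v - v1) < e' -> nrm (a *: u + v - (a *: u1 + v1)) < e.
    move=> hu hv; rewrite opprD addrACA -scalerBr.
    apply: (le_lt_trans (ler_nrmD _ _)); rewrite nrmZ.
    have -> : e = cabs a * e' + e' by rewrite /e'; field; lra.
    by rewrite ler_ltD // ler_wpM2l // ltW.
  exists (a *: x1 + x2), (a *: w1 + w2).
  by split; [exact: Glin|exact: near2|exact: near2].
have Lbd x l : L x l -> nrm l <= c * nrm x.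
  move=> Lx; apply/ler_addgt0Pl => e e0; pose e' := e / (1 + c).
  have e'0 : 0 < e' by rewrite divr_gt0 // ltr_pwDl.
  have [y [w [/Gbd g xy lw]]] := Lx _ e'0.
  have h1 := ler_nrmB x (x - y); rewrite subKr in h1.
  have h2 := ler_nrmD (l - w) w; rewrite subrK in h2.
  have h3 : c * nrm y <= c * (nrm x + e') by rewrite ler_wpM2l //; lra.
  have h6 : e = e' + c * e' by rewrite /e'; field; lra.
  rewrite mulrDr in h3; lra.
have Lex x : exists l, L x l.
  have h n : exists yw : V * W, G yw.1 yw.2 /\ nrm (x - yw.1) < n.+1%:R^-1.
    have [y [w g] xy] := Gd x n.+1%:R^-1 (ltac:(by rewrite invr_gt0)).
    by exists (y, w).
  have [u hu] := choice h.
  (* The estimate on [G] turns the convergence of the first components into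
     a Cauchy property of the second ones. *)
  have [e e0|l ul] := @cauchy_lim _ _ (fun n => (u n).2).
    have [N hN] : exists N : nat, (c + c) / e < N.+1%:R.
      by exists (Num.truncn ((c + c) / e)); exact: truncnS_gt.
    exists N => m n Nm Nn; pose r : R := N.+1%:R^-1.
    have lt1 k : (N <= k)%N -> nrm (x - (u k).1) < r.
      move=> Nk; have [_ lt] := hu k; apply: (lt_le_trans lt).
      by rewrite lef_pV2 ?posrE // ler_nat.
    have g : G ((-1) *: (u n).1 + (u m).1) ((-1) *: (u n).2 + (u m).2).
      by apply: Glin; [case: (hu n)|case: (hu m)].
    move/Gbd: g; rewrite !scaleN1r addrC [- (u n).1 + _]addrC => h2.
    have h3 := ler_dist3 (u m).1 x (u n).1.
    rewrite (nrmBC (u m).1 x) in h3.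
    have h4 : nrm ((u m).1 - (u n).1) <= r + r.
      by have := lt1 m Nm; have := lt1 n Nn => ? ?; lra.
    have h5 : (c + c) * r < e.
      by rewrite ltr_pdivrMr // mulrC -ltr_pdivrMr.
    have h6 : c * nrm ((u m).1 - (u n).1) <= c * (r + r).
      by rewrite ler_wpM2l.
    by rewrite mulrDr -mulrDl in h6; lra.
  exists l => e e0; move/cvg_nrmP: ul => /(_ e e0)[N hN].
  have [N' hN'] : exists N' : nat, e^-1 < N'.+1%:R.
    by exists (Num.truncn e^-1); exact: truncnS_gt.
  pose k := maxn N N'; have [g xk] := hu k.
  exists (u k).1, (u k).2; split=> //.
    apply: (lt_trans xk); rewrite invf_plt ?posrE //.
    by rewrite (lt_le_trans hN') // ler_nat ltnS leq_maxr.
  by rewrite nrmBC hN // leq_maxl.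
have [T hT] := choice Lex.
have Luniq x l l' : L x l -> L x l' -> l = l'.
  move=> h h'; have /Lbd := Llin (-1) _ _ _ _ h h'.
  rewrite !scaleN1r addNr nrm0 mulr0 => /nrm_le0 /eqP.
  by rewrite addrC subr_eq0 => /eqP.
exists T; last by move=> x w /GL; apply: Luniq.
split=> [a x y|x]; last exact: Lbd.
by apply: Luniq (hT _) _; apply: Llin.
Qed.

(** The form in which the extension is used: the images of a total family are
    prescribed, and the estimate is checked on finite combinations, which are
    indexed by lists to make the concatenation of two of them immediate. *)
Definition combine V J (u : J -> V) (s : seq (R[i] * J)) : V :=
  \sum_(p <- s) p.1 *: u p.2.

Definition combinations V J (u : J -> V) : set V := range (combine u).

Lemma combine_lin V W J (u : J -> V) (T : V -> W) : linear T ->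
  forall s, T (combine u s) = combine (T \o u) s.
Proof.
move=> lT s; rewrite /combine (lin_sum lT).
by apply: eq_bigr => p _; rewrite (linZ lT).
Qed.

Lemma combine_scale_cat V J (u : J -> V) a s s' :
  combine u ([seq (a * p.1, p.2) | p <- s] ++ s') =
  a *: combine u s + combine u s'.
Proof.
rewrite /combine big_cat /= big_map scaler_sumr; congr (_ + _).
by apply: eq_bigr => p _; rewrite scalerA.
Qed.

Lemma extend_family V W J (u : J -> V) (w : J -> W) c : 0 <= c ->
  dense_in (combinations u) ->
  (forall s, nrm (combine w s) <= c * nrm (combine u s)) ->
  exists2 T : V -> W, bop c T & forall j, T (u j) = w j.
Proof.
move=> c0 du bd.
pose G x z := exists2 s, x = combine u s & z = combine w s.
have [a x z y z' [s -> ->] [s' -> ->]|x z [s -> ->]||T bT hT] := @extend_op _ _ G c c0.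
- by exists ([seq (a * p.1, p.2) | p <- s] ++ s'); rewrite combine_scale_cat.
- exact: bd.
- move=> x e e0; have [_ [s _ <-] h] := du x e e0.
  by exists (combine u s) => //; exists (combine w s), s.
exists T => // j; apply: hT; exists [:: (1, j)];
  by rewrite /combine big_seq1 scale1r.
Qed.

Lemma lin_spanE V J (u : J -> V) : lin_span (range u) `<=` combinations u.
Proof.
move=> x [m [a [v [hv ->]]]].
have h i : exists k, u k = v i by have [k _ e] := hv i; exists k.
have [j hj] := choice h.
exists [seq (a i, j i) | i <- enum 'I_m] => //.
rewrite /combine big_map big_enum /=.
by apply: eq_bigr => i _; rewrite hj.
Qed.

Lemma dense_sub V (D D' : set V) : D `<=` D' -> dense_in D -> dense_in D'.
Proof.
by move=> DD dD x e /(dD x)[y /DD Dy xy]; exists y.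
Qed.

Lemma dense_combine_eq V W J (u : J -> V) (S T : V -> W) :
  bounded_op S -> bounded_op T -> dense_in (combinations u) ->
  (forall j, S (u j) = T (u j)) -> S = T.
Proof.
move=> hS hT du e; apply: (eq_dense hS hT du) => _ [s _ <-].
rewrite (combine_lin _ (proj1 hS)) (combine_lin _ (proj1 hT)).
by apply: eq_bigr => p _ /=; rewrite e.
Qed.

End Bounded.

(** * Operators on tensor products *)

Section SchurProduct.
Context {R : realType}.
Implicit Types (V W Z : hilbertType R).

(** The squared norm of [\sum T x (x) g] over the pairs [(x, g)] of [s]. *)
Definition gram V W Z (T : V -> Z) (s : seq (V * W)) : R[i] :=
  \sum_(p <- s) \sum_(q <- s) '[T p.1, T q.1] * '[p.2, q.2].

(** Gram-Schmidt on the second components: [\sum x (x) g] is rewritten with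
    pairwise orthogonal [g]'s.  The new list does not depend on [T], which is
    what makes different operators comparable. *)
Lemma gram_diag V W (s : seq (V * W)) : exists s' : seq (V * W),
  forall Z (T : V -> Z), linear T ->
    gram T s = (\sum_(p <- s') nrm (T p.1) ^+ 2 * nrm p.2 ^+ 2)%:C%C.
Proof.
have [n] := ubnP (size s); elim: n s => // n ih [|[x g] r] /=.
  by move=> _; exists [::] => Z T _; rewrite /gram !big_nil.
(* If [g] is zero then so is [b h], and the step leaves the rest as it is. *)
move=> rn; pose b (h : W) := '[h, g] / '[g, g].
have bg h : b h * '[g, g] = '[h, g].
  have [g0|g0] := eqVneq '[g, g] 0; last by rewrite /b divfK.
  by rewrite g0 mulr0 (inner_eq0 g0) inner0r.
have gb h : '[g, h] = Num.conj (b h) * '[g, g].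
  by rewrite (innerC g h) -(bg h) rmorphM /= -(innerC g g).
pose r' := [seq (p.1, p.2 - b p.2 *: g) | p <- r].
have [|s' hs'] := ih r'; first by rewrite size_map -ltnS.
pose y := \sum_(p <- r) b p.2 *: p.1.
exists ((x + y, g) :: s') => Z T lT.
have gr p q : '[p, q] = '[p - b p *: g, q - b q *: g] +
    b p * Num.conj (b q) * '[g, g].
  by rewrite innerBl !innerBr !innerZl !innerZr -(bg p) (gb q); ring.
have Ty z : '[T y, z] = \sum_(p <- r) b p.2 * '[T p.1, z].
  rewrite /y (lin_sum lT) inner_suml; apply: eq_bigr => p _.
  by rewrite (linZ lT) innerZl.
have Ty' z : '[z, T y] = \sum_(p <- r) Num.conj (b p.2) * '[z, T p.1].
  rewrite /y (lin_sum lT) inner_sumr; apply: eq_bigr => p _.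
  by rewrite (linZ lT) innerZr.
have main : gram T ((x, g) :: r) = '[T (x + y), T (x + y)] * '[g, g] + gram T r'.
  have e1 : \sum_(q <- r) '[T x, T q.1] * '[g, q.2] = '[T x, T y] * '[g, g].
    rewrite Ty' mulr_suml; apply: eq_bigr => q _.
    by rewrite (gb q.2); ring.
  have e2 : \sum_(p <- r) '[T p.1, T x] * '[p.2, g] = '[T y, T x] * '[g, g].
    by rewrite Ty mulr_suml; apply: eq_bigr => q _; rewrite -(bg q.2); ring.
  have e3 : gram T r = gram T r' + '[T y, T y] * '[g, g].
    rewrite /gram big_map Ty mulr_suml -big_split /=; apply: eq_bigr => p _.
    rewrite big_map Ty' mulr_sumr mulr_suml -big_split /=; apply: eq_bigr => q _.
    by rewrite {1}gr; ring.
  rewrite {1}/gram big_cons big_cons /=.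
  under [X in _ + X]eq_bigr do rewrite big_cons /=.
  rewrite big_split /= e1 e2 -/(gram T r) e3 (linD lT) innerDl !innerDr.
  by ring.
by rewrite main (hs' Z T lT) big_cons rmorphD rmorphM /= !innerE.
Qed.

(** This is the Schur product theorem for the Gram matrix of the [g]'s and
    the positive matrix [c ^+ 2 * '[x, x'] - '[T x, T x']]. *)
Lemma gram_le V W Z (T : V -> Z) c (s : seq (V * W)) : bop c T ->
  gram T s <= (c ^+ 2)%:C%C * gram (@id V) s.
Proof.
move=> [lT hT]; have [s' hs'] := gram_diag s.
rewrite (hs' _ _ lT) (hs' _ (@id V)) // -rmorphM lecR mulr_sumr.
apply: ler_sum => p _; rewrite [leRHS]mulrA ler_wpM2r ?sqr_ge0 // -exprMn.
by rewrite ler_sqr ?nnegrE // (le_trans _ (hT p.1)).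
Qed.

Lemma nrm_combine V W Z (T : hilbertType R) J (u : J -> T) (x : J -> V) (g : J -> W)
    (S : V -> Z) (s : seq (R[i] * J)) : linear S ->
  (forall j k, '[u j, u k] = '[S (x j), S (x k)] * '[g j, g k]) ->
  (nrm (combine u s) ^+ 2)%:C%C =
  gram S [seq (p.1 *: x p.2, g p.2) | p <- s].
Proof.
move=> lS hu; rewrite -innerE /combine inner_suml /gram big_map.
apply: eq_bigr => p _; rewrite inner_sumr big_map; apply: eq_bigr => q _ /=.
by rewrite !(linZ lS) !innerZl !innerZr hu; ring.
Qed.

(** All tensor products of operators come from this lemma: [u] and [w] stand
    for the elementary tensors before and after [S] acts on the factor that
    carries [x], and [g] for everything in the other factors. *)
Lemma factor_op V W Z (T T' : hilbertType R) J (u : J -> T) (w : J -> T') (x : J -> V)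
    (g : J -> W) (S : V -> Z) c :
  0 <= c -> bop c S ->
  (forall j k, '[u j, u k] = '[x j, x k] * '[g j, g k]) ->
  (forall j k, '[w j, w k] = '[S (x j), S (x k)] * '[g j, g k]) ->
  dense_in (combinations u) ->
  exists2 F : T -> T', bop c F & forall j, F (u j) = w j.
Proof.
move=> c0 bS hu hw du; apply: extend_family => // s.
rewrite -ler_sqr ?nnegrE ?mulr_ge0 // exprMn -lecR.
rewrite (rmorphM (real_complex R) (c ^+ 2)) /=.
rewrite (nrm_combine s (proj1 bS) hw) (@nrm_combine _ _ _ _ _ _ _ _ id s _ hu) //.
exact: gram_le.
Qed.

End SchurProduct.

Section Tensor2.
Context {R : realType}.
Context {V W T : hilbertType R} (t : V -> W -> T) (t_tensor : is_tensor2 t).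

Let u (p : V * W) := t p.1 p.2.

Lemma tensor2_dense : dense_in (combinations u).
Proof.
apply: dense_sub (closure_dense (proj2 t_tensor)) => z [m [a [v [hv e]]]].
apply: lin_spanE; exists m, a, v; split=> // i.
by have [x [y ->]] := hv i; exists (x, y).
Qed.

Lemma tensor2_opP c d (F : V -> V) (G : W -> W) :
  0 <= c -> 0 <= d -> bop c F -> bop d G ->
  exists2 U, bop (c * d) U & is_tensor2_op t F G U.
Proof.
move=> c0 d0 bF bG; have [ht _] := t_tensor.
have [U1 b1 h1] := @factor_op _ _ _ _ _ _ _ u (fun p => t (F p.1) p.2)
  (fun p => p.1) (fun p => p.2) F c c0 bF (fun p q => ht _ _ _ _)
  (fun p q => ht _ _ _ _) tensor2_dense.
have [U2 b2 h2] := @factor_op _ _ _ _ _ _ _ u (fun p => t p.1 (G p.2))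
  (fun p => p.2) (fun p => p.1) G d d0 bG
  (fun p q => etrans (ht _ _ _ _) (mulrC _ _))
  (fun p q => etrans (ht _ _ _ _) (mulrC _ _)) tensor2_dense.
have b12 := bop_comp c0 b1 b2.
exists (U1 \o U2) => //; split; first by apply: bop_bounded b12; rewrite mulr_ge0.
by move=> x y /=; rewrite (h2 (x, y)) (h1 (x, G y)).
Qed.

Lemma tensor2_op_uniq (F : V -> V) (G : W -> W) U U' :
  is_tensor2_op t F G U -> is_tensor2_op t F G U' -> U = U'.
Proof.
move=> [bU hU] [bU' hU']; apply: (dense_combine_eq bU bU' tensor2_dense).
by move=> [x y]; rewrite /u hU hU'.
Qed.

Lemma tensor2_linr a x y z : t x (a *: y + z) = a *: t x y + t x z.
Proof.
have [ht _] := t_tensor; apply/eqP; rewrite -subr_eq0; apply/eqP/inner_eq0.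
rewrite !innerBl !innerBr !innerDl !innerDr !innerZl !innerZr !ht.
by rewrite !innerDl !innerDr !innerZl !innerZr; ring.
Qed.

Lemma tensor2_0r x : t x 0 = 0.
Proof. by have [ht _] := t_tensor; apply: inner_eq0; rewrite ht inner0l mulr0. Qed.

End Tensor2.

Section FiniteTensor.
Context {R : realType} {I : finType} {V : I -> hilbertType R}.
Context {T : hilbertType R} (t : (forall i, V i) -> T) (t_tensor : is_tensor t).
Implicit Types (S : forall i, V i -> V i) (F : T -> T).

Lemma tensor_dense : dense_in (combinations t).
Proof. exact: dense_sub (@lin_spanE _ _ _ t) (closure_dense (proj2 t_tensor)). Qed.

Lemma inner_dfwith x i u y :
  '[t (dfwith x i u), t y] = '[u, y i] * \prod_(j | j != i) '[x j, y j].
Proof.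
rewrite (proj1 t_tensor) (bigD1 i) //= dfwithin; congr (_ * _).
by apply: eq_bigr => j ji; rewrite dfwithout // eq_sym.
Qed.

Lemma tensor_dfwithB x i u v :
  t (dfwith x i (u - v)) = t (dfwith x i u) - t (dfwith x i v).
Proof.
apply/eqP; rewrite -subr_eq0; apply/eqP/inner_eq0.
rewrite !innerBr !innerBl !inner_dfwith !innerBl.
by ring.
Qed.

Lemma tensor_eq0 x i : x i = 0 -> t x = 0.
Proof.
move=> x0; apply: inner_eq0; rewrite (proj1 t_tensor) (bigD1 i) //= x0.
by rewrite inner0l mul0r.
Qed.

(** For the first [n] spaces of a sequence this is [is_fin_tensor_op], to which
    the results below apply by conversion. *)
Definition tensor_op S F :=
  bounded_op F /\ forall x, F (t x) = t (fun i => S i (x i)).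

Lemma tensor_op_uniq S F F' : tensor_op S F -> tensor_op S F' -> F = F'.
Proof.
move=> [bF hF] [bF' hF']; apply: (dense_combine_eq bF bF' tensor_dense) => x.
by rewrite hF hF'.
Qed.

Lemma dfwith_eq (x y : forall i, V i) i u :
  y i = u -> (forall j, j != i -> y j = x j) -> dfwith x i u = y.
Proof.
move=> yi yj; apply: functional_extensionality_dep => j.
by case: dfwithP => [//|k]; rewrite eq_sym => /yj.
Qed.

(** A unit vector [v] of the factor [i] makes the other factors embed into
    the tensor product itself, whence the vectors [g] of [factor_op]. *)
Lemma slot_op i (S : V i -> V i) (v : V i) c :
  0 <= c -> bop c S -> nrm v = 1 ->
  exists2 F, bop c F & forall x, F (t x) = t (dfwith x i (S (x i))).
Proof.
move=> c0 bS v1.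
have vv : '[v, v] = 1 by rewrite innerE v1 expr1n.
have dfK (x y : forall k, V k) (u w : V i) :
    \prod_(j | j != i) '[x j, dfwith y i w j] =
    \prod_(j | j != i) '[dfwith x i u j, y j].
  by apply: eq_bigr => j ji; rewrite !dfwithout // eq_sym.
apply: (@factor_op _ _ _ _ _ _ _ t _ (fun x => x i)
  (fun x => t (dfwith x i v)) S c) => //.
- move=> x y; rewrite inner_dfwith dfwithin vv mul1r (dfK _ _ (x i)).
  by rewrite (proj1 t_tensor) (bigD1 i) //= (dfwith_eq (x := x) (y := x)).
- by move=> x y; rewrite !inner_dfwith !dfwithin vv mul1r !(dfK _ _ v).
- exact: tensor_dense.
Qed.

Context (v : forall i, V i) (v_unit : forall i, nrm (v i) = 1).

Lemma tensor_op_ex S (c : I -> R) :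
  (forall i, 0 <= c i) -> (forall i, bop (c i) (S i)) ->
  exists2 F, bop (\prod_i c i) F & tensor_op S F.
Proof.
move=> c0 bS.
have h (s : seq I) : uniq s -> exists2 F, bop (\prod_(i <- s) c i) F &
    forall x, F (t x) = t (fun i => if i \in s then S i (x i) else x i).
  elim: s => [_|i s ih /= /andP[nis /ih[F bF hF]]].
    by exists id; rewrite ?big_nil //; exact: bop_id.
  have [G bG hG] := slot_op (c0 i) (bS i) (v_unit i).
  exists (G \o F); first by rewrite big_cons; exact: bop_comp.
  move=> x /=; rewrite hF hG; congr t; apply: dfwith_eq => [|j ji].
    by rewrite inE eqxx /= (negbTE nis).
  by rewrite inE (negbTE ji).
have [|F bF hF] := h (index_enum I); first exact: index_enum_uniq.
exists F => //; split.
  by apply: bop_bounded bF; rewrite prodr_ge0.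
move=> x; rewrite hF; congr t; apply: functional_extensionality_dep => i.
by rewrite mem_index_enum.
Qed.

Lemma tensor_op_bop S F (c : I -> R) :
  (forall i, 0 <= c i) -> (forall i, bop (c i) (S i)) -> tensor_op S F ->
  bop (\prod_i c i) F.
Proof.
move=> c0 bS hF; have [F' bF' hF'] := tensor_op_ex c0 bS.
by rewrite (tensor_op_uniq hF hF').
Qed.

(** The factors are replaced one after the other; [a] bounds the factors that
    are not being replaced, and [1 <= a] allows all of them to be included in
    the product. *)
Lemma tensor_op_dist S S' F F' (a d : I -> R) :
  (forall i, 1 <= a i) -> (forall i, 0 <= d i) ->
  (forall i, bop (a i) (S i)) -> (forall i, bop (a i) (S' i)) ->
  (forall i, bop (d i) (S i - S' i)) ->
  tensor_op S F -> tensor_op S' F' ->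
  bop (\prod_i a i * \sum_i d i) (F - F').
Proof.
move=> a1 d0 bS bS' bd hF hF'.
have a0 i : 0 <= a i by rewrite (le_trans ler01).
pose mix (s : seq I) i := if i \in s then S i else S' i.
have bmix s i : bop (a i) (mix s i) by rewrite /mix; case: ifP.
have h (s : seq I) : uniq s -> forall G, tensor_op (mix s) G ->
    bop (\prod_i a i * \sum_(i <- s) d i) (G - F').
  elim: s => [_ G hG|i s ih /= /andP[nis us] G hG].
    have -> : G = F'.
      apply: tensor_op_uniq hF'; split; first exact: proj1 hG.
      by move=> x; rewrite (proj2 hG).
    by rewrite subrr big_nil mulr0; exact: bop0.
  have [G' _ hG'] := tensor_op_ex a0 (bmix s).
  pose diff := dfwith (mix s) i (S i - S' i).
  pose b := dfwith a i (d i).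
  have b0 j : 0 <= b j by rewrite /b; case: dfwithP.
  have bdiff j : bop (b j) (diff j).
    rewrite /b /diff; case: (eqVneq i j) => [<-|ij].
      by rewrite !dfwithin.
    by rewrite !dfwithout.
  have [D bD hD] := tensor_op_ex b0 bdiff.
  have GD : G - G' = D.
    apply: (dense_combine_eq _ (proj1 hD) tensor_dense).
      by apply: boundedB; [case: hG|case: hG'].
    move=> x; rewrite (proj2 hD) [(G - G') _](_ : _ = G (t x) - G' (t x)) //.
    rewrite (proj2 hG) (proj2 hG').
    pose y j := mix s j (x j).
    transitivity (t (dfwith y i (S i (x i))) - t (dfwith y i (S' i (x i)))).
      congr (t _ - t _); apply/esym/dfwith_eq => [|j ji]; rewrite /y /mix.
      - by rewrite inE eqxx.
      - by rewrite inE (negbTE ji).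
      - by rewrite (negbTE nis).
      - by [].
    rewrite -tensor_dfwithB; congr t; apply: dfwith_eq => [|j ji].
      by rewrite /diff dfwithin.
    by rewrite /diff dfwithout // eq_sym.
  have -> : G - F' = 1 *: D + (G' - F').
    by rewrite scale1r -GD addrA subrK.
  rewrite big_cons mulrDr.
  have := bop_lin 1 bD (ih us G' hG').
  rewrite /cabs normr1 mul1r; apply: bopW; rewrite lerD2r.
  rewrite (bigD1 i) //= [leRHS]mulrC [in leRHS](bigD1 i) //= {1}/b dfwithin.
  rewrite ler_wpM2l //.
  rewrite (eq_bigr a); last by move=> j ji; rewrite /b dfwithout // eq_sym.
  by rewrite ler_peMl // prodr_ge0.
apply: (h _ (index_enum_uniq I) F); split; first exact: proj1 hF.
move=> x; rewrite (proj2 hF); congr t.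
by apply: functional_extensionality_dep => i; rewrite /mix mem_index_enum.
Qed.

End FiniteTensor.

(** * Summable sequences *)

Section Summable.
Context {R : realType}.
Implicit Types (d u v : nat -> R).

Lemma sum_ndec d m n : (forall i, 0 <= d i) -> (m <= n)%N ->
  \sum_(i < m) d i <= \sum_(i < n) d i.
Proof.
move=> d0 mn; rewrite -(subnK mn); elim: (n - m)%N => // k ih.
by rewrite addSn big_ord_recr /= (le_trans ih) // lerDl.
Qed.

Lemma ndec_cvgP (s : nat -> R) :
  (forall m n, (m <= n)%N -> s m <= s n) ->
  cvgn s <-> exists L, forall m, s m <= L.
Proof.
move=> s_ndec; split=> [cs|[L hL]].
  by exists (limn s) => m; apply: nondecreasing_cvgn_le.
apply: nondecreasing_is_cvgn => //.
by exists L => _ [m _ <-].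
Qed.

Lemma summableP d : (forall i, 0 <= d i) ->
  cvgn (series d) <-> exists L, forall m, \sum_(i < m) d i <= L.
Proof.
by move=> d0; rewrite seriesEord; apply: ndec_cvgP => m n; apply: sum_ndec.
Qed.

Lemma summable_dom u v k : (forall i, 0 <= u i) -> (forall i, 0 <= v i) ->
  (forall i, (k <= i)%N -> u i <= v i) ->
  cvgn (series v) -> cvgn (series u).
Proof.
move=> u0 v0 uv /(summableP v0)[L hL]; apply/(summableP u0).
exists (\sum_(i < k) u i + L) => m.
apply: (le_trans (sum_ndec u0 (leq_addl k m))).
apply: (@le_trans _ _ (\sum_(i < k) u i + \sum_(i < k + m) v i)).
  elim: m => [|m ih].
    by rewrite addn0 lerDl sumr_ge0.
  by rewrite addnS 2!big_ord_recr /= addrA lerD // uv // leq_addr.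
by rewrite lerD2l.
Qed.

Lemma summable_tail d (e : R) : (forall i, 0 <= d i) -> cvgn (series d) ->
  0 < e -> exists N, forall m, \sum_(i < m) (if (i < N)%N then 0 else d i) <= e.
Proof.
move=> d0 cd e0; rewrite seriesEord in cd.
have ub m : \sum_(i < m) d i <= limn (fun n => \sum_(k < n) d k).
  by apply: nondecreasing_cvgn_le => // i j; apply: sum_ndec.
have /cvgrPdist_lt/(_ e e0)[N _ /(_ N (leqnn N))] := cd.
rewrite /= ger0_norm ?subr_ge0; last exact: ub.
move=> hN; exists N => m.
have h0 i : 0 <= (if (i < N)%N then 0 else d i) by case: ifP.
apply: (le_trans (sum_ndec h0 (leq_addl N m))).
suff -> : \sum_(i < N + m) (if (i < N)%N then 0 else d i) =
    \sum_(i < N + m) d i - \sum_(i < N) d i.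
  by have := ub (N + m)%N => ?; lra.
elim: m => [|m ih].
  by rewrite addn0 subrr big1 // => i _; rewrite ltn_ord.
by rewrite addnS 2!big_ord_recr /= ih ltnNge leq_addr /= addrAC.
Qed.

Lemma prod_max_bounded (s : nat -> R) d :
  (forall i, 0 <= d i) -> (forall i, s i <= 1 + d i) -> cvgn (series d) ->
  exists2 P, 1 <= P & forall m, \prod_(i < m) Num.max (s i) 1 <= P.
Proof.
move=> d0 sd /(summableP d0)[L hL]; exists (expR L).
  by rewrite -expR0 ler_expR (le_trans _ (hL 0%N)) // big_ord0.
move=> m; apply: (@le_trans _ _ (expR (\sum_(i < m) d i))); last by rewrite ler_expR.
elim: m => [|m ih]; first by rewrite !big_ord0 expR0.
rewrite !big_ord_recr /= expRD; apply: ler_pM => //.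
- by apply: prodr_ge0 => i _; rewrite le_max ler01 orbT.
- by rewrite le_max ler01 orbT.
rewrite ge_max (le_trans (sd m)) ?expR_ge1Dx //=.
by rewrite (le_trans _ (expR_ge1Dx _)) // lerDl.
Qed.

End Summable.

(** * Infinite tensor products of operators *)

Section InfiniteTensorProduct.
Context {R : realType} {H : nat -> hilbertType R} {xi : forall n, H n}.
Context (xi_unit : forall n, `|xi n| = 1) (X : infinite_tensor xi).
Implicit Types S B : forall n, H n -> H n.

Lemma isometry_nrm (V W : hilbertType R) (J : V -> W) :
  isometric_op J -> forall x, nrm (J x) = nrm x.
Proof. by move=> [_ hJ] x; rewrite /nrm hJ. Qed.

Lemma isometry_inj (V W : hilbertType R) (J : V -> W) :
  isometric_op J -> forall x y, J x = J y -> x = y.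
Proof.
move=> iJ x y e; apply/eqP; rewrite -subr_eq0; apply/eqP/nrm_le0.
by rewrite -(isometry_nrm iJ) (linB (proj1 iJ)) e subrr nrm0.
Qed.

Lemma isometry_bounded (V W : hilbertType R) (J : V -> W) :
  isometric_op J -> bounded_op J.
Proof.
move=> iJ; apply: (bop_bounded ler01); split; first exact: (proj1 iJ).
by move=> x; rewrite (isometry_nrm iJ) mul1r.
Qed.

Let iconn n m (nm : (n <= m)%N) := conn_isometric X nm.
Let iembed n := embed_isometric X n.

Lemma conn_conn n m p (z : fin_tensor X n) : (n <= m)%N -> (m <= p)%N ->
  conn p (conn m z) = conn p z.
Proof.
move=> nm mp; apply: (isometry_inj (iembed p)).
by rewrite !embed_conn // (leq_trans nm).
Qed.

(** The connecting maps are specified on families over all positions. *)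
Lemma total_family n (eta : forall k : 'I_n, H k) :
  exists eta' : forall k, H k, (fun k : 'I_n => eta' k) = eta.
Proof.
have h k : exists v : H k, forall kn : (k < n)%N, v = eta (Ordinal kn).
  have [kn|kn] := EM (k < n)%N; last by exists (xi k) => kn'; case: kn.
  by exists (eta (Ordinal kn)) => kn'; rewrite (bool_irrelevance kn' kn).
pose eta' k : H k := projT1 (cid (h k)).
exists eta'; apply: functional_extensionality_dep => -[k kn].
by rewrite /eta' /=; case: cid => v /= ->.
Qed.

Definition fin_bound S m := \prod_(n < m) Num.max (opnorm (S n)) 1.

Lemma fin_bound_ge1 S m : 1 <= fin_bound S m.
Proof.
rewrite /fin_bound; elim: m => [|m ih]; first by rewrite big_ord0.
by rewrite big_ord_recr /= mulr_ege1 // le_max lexx orbT.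
Qed.

Lemma fin_bound_ge0 S m : 0 <= fin_bound S m.
Proof. by rewrite (le_trans ler01) ?fin_bound_ge1. Qed.

Let unit_xi n : nrm (xi n) = 1 := nrm1P (xi_unit n).

Lemma fin_op_ex S m : (forall n, bounded_op (S n)) ->
  exists F : fin_tensor X m -> fin_tensor X m, is_fin_tensor_op S F.
Proof.
move=> bS.
have [F _ hF] := tensor_op_ex (elemP X m) (fun i => unit_xi i)
  (fun i : 'I_m => opnorm_ge0 (bS i)) (fun i : 'I_m => opnorm_bop (bS i)).
by exists F.
Qed.

Lemma fin_op_bop S m (F : fin_tensor X m -> fin_tensor X m) :
  (forall n, bounded_op (S n)) -> is_fin_tensor_op S F -> bop (fin_bound S m) F.
Proof.
move=> bS hF; apply: (tensor_op_bop (elemP X m) (fun i => unit_xi i) _ _ hF).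
  by move=> i; rewrite le_max ler01 orbT.
move=> i; apply: bopW (opnorm_bop (bS i)).
by rewrite le_max lexx.
Qed.

Lemma fin_op_dist S S' m (F F' : fin_tensor X m -> fin_tensor X m) :
  (forall n, bounded_op (S n)) -> (forall n, bounded_op (S' n)) ->
  is_fin_tensor_op S F -> is_fin_tensor_op S' F' ->
  bop (fin_bound S m * fin_bound S' m * \sum_(n < m) opnorm (S n - S' n)) (F - F').
Proof.
move=> bS bS' hF hF'; rewrite /fin_bound -big_split /=.
have max1 (x : R) : 1 <= Num.max x 1 by rewrite le_max lexx orbT.
apply: (tensor_op_dist (elemP X m) (fun i => unit_xi i) _ _ _ _ _ hF hF') => i.
- by rewrite mulr_ege1.
- exact/opnorm_ge0/boundedB.
- apply: bopW (opnorm_bop (bS i)).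
  rewrite (@le_trans _ _ (Num.max (opnorm (S i)) 1)) ?le_max ?lexx //.
  by rewrite ler_peMr // (le_trans ler01).
- apply: bopW (opnorm_bop (bS' i)).
  rewrite (@le_trans _ _ (Num.max (opnorm (S' i)) 1)) ?le_max ?lexx //.
  by rewrite ler_peMl // (le_trans ler01).
- exact/opnorm_bop/boundedB.
Qed.

Lemma fin_op_conn S m p (F : fin_tensor X m -> fin_tensor X m)
    (G : fin_tensor X p -> fin_tensor X p) :
  (m <= p)%N -> is_fin_tensor_op S F -> is_fin_tensor_op S G ->
  (forall k, (m <= k)%N -> S k (xi k) = xi k) ->
  forall z, G (conn p z) = conn p (F z).
Proof.
move=> mp [bF hF] [bG hG] fix_xi z.
have bconn := isometry_bounded (iconn mp).
suff e : G \o conn p = conn p \o F by rewrite -[LHS]/((G \o conn p) z) e.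
apply: (dense_combine_eq _ _ (tensor_dense (elemP X m))); try exact: bounded_comp.
move=> eta; have [eta' <-] := total_family eta => /=.
rewrite hF (conn_elem X mp) hG (conn_elem X mp (fun k => S k (eta' k))).
congr elem; apply: functional_extensionality_dep => k.
by case: ifP => // /negbT; rewrite -leqNgt => /fix_xi.
Qed.

Lemma inf_op_bop S (T : lim_tensor X -> lim_tensor X) :
  is_inf_tensor_op S T -> bounded_op T.
Proof. by case. Qed.

Lemma embed_dense_in : dense_in (\bigcup_n range (@embed _ _ _ X n)).
Proof. exact: closure_dense (embed_dense X). Qed.

(** The bound of [fin_op_dist] does not grow with the level, so that it
    passes to the limit and then, by density, to the whole space. *)
Lemma inf_op_dist S S' (T T' : lim_tensor X -> lim_tensor X) (P P' s : R) :
  (forall n, bounded_op (S n)) -> (forall n, bounded_op (S' n)) ->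
  (forall m, fin_bound S m <= P) -> (forall m, fin_bound S' m <= P') ->
  (forall m, \sum_(n < m) opnorm (S n - S' n) <= s) ->
  is_inf_tensor_op S T -> is_inf_tensor_op S' T' -> bop (P * P' * s) (T - T').
Proof.
move=> bS bS' hP hP' hs [bT [F [hF FT]]] [bT' [F' [hF' FT']]].
have P0 : 0 <= P by rewrite (le_trans _ (hP 0%N)) ?fin_bound_ge0.
have P'0 : 0 <= P' by rewrite (le_trans _ (hP' 0%N)) ?fin_bound_ge0.
have s0 : 0 <= s by rewrite (le_trans _ (hs 0%N)) // big_ord0.
have [d d0 hd] := proj1 (bounded_opP _) (boundedB bT bT').
apply: (bop_dense _ d0 hd embed_dense_in); first by rewrite !mulr_ge0.
move=> _ [n _ [z _ <-]].
have lim : (fun m => embed (F m (conn m z)) - embed (F' m (conn m z))) @ \oo -->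
    (T - T') (embed z).
  exact: cvgB (FT n z) (FT' n z).
apply: (cvg_nrm_le (N := n) lim) => m nm.
rewrite -(linB (proj1 (iembed m))) (isometry_nrm (iembed m)).
rewrite (isometry_nrm (iembed n)) -(isometry_nrm (iconn nm) z).
apply: (le_trans (proj2 (fin_op_dist bS bS' (hF m) (hF' m)) _)).
apply: ler_wpM2r => //; apply: ler_pM => //.
- by rewrite mulr_ge0 ?fin_bound_ge0.
- by apply: sumr_ge0 => i _; apply/opnorm_ge0/boundedB.
- by apply: ler_pM; rewrite ?fin_bound_ge0.
Qed.

Section Near.
Context (A : forall n, H n -> H n).
Arguments A n _ : clear implicits.
Context (A_bounded : forall n, bounded_op (A n)).
Context (A_norm : forall n, opnorm (A n) = 1).
Context (A_xi : forall n, A n (xi n) = xi n).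

(** The sequences whose infinite tensor product is to be formed all satisfy
    this condition, which is stable under a change of finitely many factors
    and lets the sequences with tails [A], [M] and [M^*] be treated alike. *)
Definition summably_close S := (forall n, bounded_op (S n)) /\
  cvgn (series (fun n => opnorm (S n - A n))).

Let dist_ge0 S : (forall n, bounded_op (S n)) -> forall n, 0 <= opnorm (S n - A n).
Proof. by move=> bS n; apply/opnorm_ge0/boundedB. Qed.

Lemma close_refl : summably_close A.
Proof.
split=> //; apply/summableP; first exact: dist_ge0.
exists 0 => m; rewrite big1 // => n _; apply/eqP.
by rewrite eq_le dist_ge0 // opnormBB.
Qed.

Lemma close_tail S B k : summably_close B -> (forall n, bounded_op (S n)) ->
  (forall n, (k <= n)%N -> S n = B n) -> summably_close S.
Proof.
move=> [bB cB] bS SB; split=> //.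
have le (n : nat) : (k <= n)%N -> opnorm (S n - A n) <= opnorm (B n - A n).
  by move=> /SB ->.
exact: (summable_dom (dist_ge0 bS) (dist_ge0 bB) le cB).
Qed.

Lemma close_bounded S : summably_close S ->
  exists2 P, 1 <= P & forall m, fin_bound S m <= P.
Proof.
move=> [bS cS]; suff le (n : nat) : opnorm (S n) <= 1 + opnorm (S n - A n).
  exact: (prod_max_bounded (dist_ge0 bS) le cS).
rewrite -(A_norm n) -{1}[S n](subrK (A n)) addrC.
by apply: opnormD => //; apply: boundedB.
Qed.

Lemma close_admissible S : summably_close S -> admissible xi S.
Proof.
move=> nS; have [bS cS] := nS; have [P _ hP] := close_bounded nS; split=> //.
  apply/ndec_cvgP; last by exists P.
  move=> m n mn; rewrite -(subnK mn); elim: (n - m)%N => // k ih.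
  rewrite addSn big_ord_recr /= (le_trans ih) // ler_peMr //.
    exact: fin_bound_ge0.
  by rewrite le_max lexx orbT.
suff le (n : nat) : (0 <= n)%N -> nrm (S n (xi n) - xi n) <= opnorm (S n - A n).
  exact: (summable_dom (fun n => nrm_ge0 _) (dist_ge0 bS) le cS).
move=> _; have /opnorm_bop[_ /(_ (xi n))] := boundedB (bS n) (A_bounded n).
by rewrite unit_xi mulr1 [(S n - A n) _](_ : _ = S n (xi n) - A n (xi n)) // A_xi.
Qed.

(** With the factors of [A] from [m] on, which fix [xi], the operators of the
    levels [m] and [p] would agree along the connecting map; the right-hand
    side is the cost of replacing the factors of [S] by these. *)
Lemma fin_op_cauchy S (F : forall m, fin_tensor X m -> fin_tensor X m) P m p z :
  summably_close S -> (forall m, fin_bound S m <= P) ->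
  (forall m, is_fin_tensor_op S (F m)) -> (m <= p)%N ->
  nrm (F p (conn p z) - conn p (F m z)) <=
  P * P * (\sum_(n < p) if (n < m)%N then 0 else opnorm (S n - A n)) * nrm z.
Proof.
move=> [bS cS] hP hF mp.
pose S' n : H n -> H n := if (n < m)%N then S n else A n.
have bS' n : bounded_op (S' n) by rewrite /S'; case: ifP.
have [G hG] := fin_op_ex p bS'.
have hFm : is_fin_tensor_op S' (F m).
  split; first exact: proj1 (hF m).
  move=> eta; rewrite (proj2 (hF m)); congr elem.
  by apply: functional_extensionality_dep => k; rewrite /S' ltn_ord.
rewrite -(fin_op_conn mp hFm hG); last first.
  by move=> k mk; rewrite /S' ltnNge mk /= A_xi.
have hS' : fin_bound S' p <= P.
  apply: le_trans (hP p); apply: ler_prod => n _.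
  rewrite le_max ler01 orbT /= /S'; case: ifP => // _.
  by rewrite A_norm ge_max le_max lexx orbT.
rewrite -(isometry_nrm (iconn mp) z).
apply: (le_trans (proj2 (fin_op_dist bS bS' (hF p) hG) _)).
apply: ler_wpM2r => //; apply: ler_pM.
- by rewrite mulr_ge0 ?fin_bound_ge0.
- by apply: sumr_ge0 => i _; apply/opnorm_ge0/boundedB.
- by apply: ler_pM; rewrite ?fin_bound_ge0.
apply: ler_sum => n _; rewrite /S'; case: ifP => // _.
exact: opnormBB.
Qed.

Lemma close_inf_op S : summably_close S ->
  exists T : lim_tensor X -> lim_tensor X, is_inf_tensor_op S T.
Proof.
move=> nS; have [bS cS] := nS; have [P P1 hP] := close_bounded nS.
have P0 : 0 <= P by rewrite (le_trans ler01).
have [F hF] : exists F : forall m, fin_tensor X m -> fin_tensor X m,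
    forall m, is_fin_tensor_op S (F m).
  by exists (fun m => projT1 (cid (fin_op_ex m bS))) => m; case: cid.
pose u n (z : fin_tensor X n) m := embed (F m (conn m z)).
pose G x (w : lim_tensor X) :=
  exists n (z : fin_tensor X n), x = embed z /\ u n z @ \oo --> w.
have lim n (z : fin_tensor X n) : exists w : lim_tensor X, u n z @ \oo --> w.
  apply: cauchy_lim => e e0.
  (* A tail sum of [e / C] is multiplied by [P * P * nrm z]. *)
  pose C := 4 * P * P * (1 + nrm z).
  have C0 : 0 < C by rewrite !mulr_gt0 ?ltr_wpDr // (lt_le_trans ltr01).
  have [N hN] := summable_tail (dist_ge0 bS) cS (divr_gt0 e0 C0).
  have step m : (maxn N n <= m)%N -> nrm (u n z m - u n z (maxn N n)) <= e / 4.
    set k := maxn N n => km; have nk : (n <= k)%N by rewrite leq_maxr.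
    rewrite /u -(conn_conn z nk km) -(embed_conn km (F k _)).
    rewrite -(linB (proj1 (iembed m))) (isometry_nrm (iembed m)).
    apply: (le_trans (fin_op_cauchy _ nS hP hF km)).
    rewrite (isometry_nrm (iconn nk)).
    apply: (@le_trans _ _ (P * P * (e / C) * nrm z)).
      apply: ler_wpM2r => //; apply: ler_wpM2l; first exact: mulr_ge0.
      apply: le_trans (hN m); apply: ler_sum => i _.
      case: ltnP => ki; case: ltnP => // Ni; first exact: dist_ge0.
      by rewrite leqNgt (leq_trans Ni) ?leq_maxl in ki.
    have -> : e / 4 = P * P * (e / C) * (1 + nrm z).
      have z1 : 1 + nrm z != 0 by rewrite gt_eqF // ltr_wpDr.
      have Pn0 : P != 0 by rewrite gt_eqF // (lt_le_trans ltr01).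
      by rewrite /C; field; rewrite z1.
    apply: ler_wpM2l; last by rewrite lerDr.
    by rewrite !mulr_ge0 ?invr_ge0 // ltW.
  exists (maxn N n) => m p /step h1 /step h2.
  have := ler_dist3 (u n z m) (u n z (maxn N n)) (u n z p).
  by rewrite (nrmBC (u n z (maxn N n))) => h3; lra.
have shift n (z : fin_tensor X n) p m : (n <= p)%N -> (p <= m)%N ->
    u p (conn p z) m = u n z m.
  by move=> np pm; rewrite /u conn_conn.
have [a x w y w' [n [z [-> hz]]] [n' [z' [-> hz']]]|x w [n [z [-> hz]]]||T bT hT]
    := @extend_op _ _ _ G P P0.
- pose p := maxn n n'; have [np n'p] : (n <= p)%N /\ (n' <= p)%N.
    by rewrite leq_maxl leq_maxr.
  exists p, (a *: conn p z + conn p z'); split.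
    by rewrite (proj1 (iembed p)) !embed_conn.
  have : (fun m => a *: u n z m + u n' z' m) @ \oo --> a *: w + w'.
    by apply: cvgD hz'; apply: cvgZr hz.
  apply: cvg_trans; apply: near_eq_cvg; exists p => // m /= pm.
  rewrite -(shift n z p m) // -(shift n' z' p m) // /u.
  by rewrite (proj1 (iconn pm)) (proj1 (proj1 (hF m))) (proj1 (iembed m)).
- apply: (cvg_nrm_le (N := n) hz) => m nm; rewrite /u.
  rewrite !(isometry_nrm (iembed _)) -(isometry_nrm (iconn nm) z).
  apply: (le_trans (proj2 (fin_op_bop bS (hF m)) _)).
  exact: ler_wpM2r.
- apply: dense_sub embed_dense_in => _ [n _ [z _ <-]].
  by have [w hw] := lim n z; exists w, n, z.
exists T; split; first exact: bop_bounded bT.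
exists F; split=> // n z; have [w hw] := lim n z.
by rewrite (hT (embed z) w) //; exists n, z.
Qed.

(** A tensor product of [S] with tail [B] is approximated by changing only the
    far factors of [S] into those of [B'].  Both sequences are summably close
    to [A], so that their distances have small tail sums. *)
Lemma close_approx B B' : summably_close B -> summably_close B' ->
  eventually_tensor (X := X) B `<=` norm_closure (eventually_tensor (X := X) B').
Proof.
move=> nB nB' T [S [[bS _ _] [k SB] ST]]; split; first exact: inf_op_bop ST.
have nS : summably_close S := close_tail nB bS SB.
have [P P1 hP] := close_bounded nS; have [P' P'1 hP'] := close_bounded nB'.
have [_ cS] := nS; have [bB' cB'] := nB'.
pose d n := opnorm (S n - B' n).
have d0 n : 0 <= d n by apply/opnorm_ge0/boundedB.
have cd : cvgn (series d).
  have : cvgn (series (fun n => opnorm (S n - A n) + opnorm (B' n - A n))).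
    exact: is_cvg_seriesD.
  apply: (@summable_dom _ d _ 0) => // [n|n _].
    by rewrite addr_ge0 ?dist_ge0.
  by rewrite (opnormBC (bB' n) (A_bounded n)) opnorm_dist3.
move=> e e0.
have P0 : 0 < P by rewrite (lt_le_trans ltr01).
have P'0 : 0 < P' by rewrite (lt_le_trans ltr01).
(* [P * P'] bounds the partial products of the mixed sequence [S']. *)
pose C := 2 * P * (P * P').
have C0 : 0 < C by rewrite !mulr_gt0.
have [N hN] := summable_tail d0 cd (divr_gt0 e0 C0).
pose S' n : H n -> H n := if (n < N)%N then S n else B' n.
have bS' n : bounded_op (S' n) by rewrite /S'; case: ifP.
have S'B n : (N <= n)%N -> S' n = B' n by rewrite /S' leqNgt => /negbTE ->.
have nS' := close_tail nB' bS' S'B.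
have [T' hT'] := close_inf_op nS'.
exists T'.
  by exists S'; split=> //; [exact: close_admissible|exists N].
have hPP' m : fin_bound S' m <= P * P'.
  apply: (@le_trans _ _ (fin_bound S m * fin_bound B' m)); last first.
    by apply: ler_pM; rewrite ?fin_bound_ge0.
  rewrite /fin_bound -big_split /=; apply: ler_prod => n _.
  have max1 (x : R) : 1 <= Num.max x 1 by rewrite le_max lexx orbT.
  have max0 (x : R) : 0 <= Num.max x 1 by rewrite (le_trans ler01).
  by rewrite max0 /= /S'; case: ifP => _; rewrite ?ler_peMl ?ler_peMr.
have hs m : \sum_(n < m) opnorm (S n - S' n) <= e / C.
  apply: le_trans (hN m); apply: ler_sum => n _; rewrite /S'; case: ifP => // _.
  exact: opnormBB.
have C'0 : 0 <= P * (P * P') * (e / C) by rewrite !mulr_ge0 ?invr_ge0 // ltW.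
apply: (le_lt_trans (opnorm_le C'0 (inf_op_dist bS bS' hP hPP' hs ST hT'))).
have -> : P * (P * P') * (e / C) = e / 2 by rewrite /C; field; rewrite !gt_eqF.
by lra.
Qed.

End Near.
End InfiniteTensorProduct.

(** * Adjoints *)

Section Adjoint.
Context {R : realType}.
Implicit Types (V W : hilbertType R) (a b : R[i]) (c : R).

(** A sesquilinear form over the complex numbers is determined by its
    diagonal: the scalars [1] and ['i] separate [q x y] from [q y x]. *)
Lemma polarization V (q : V -> V -> R[i]) :
  (forall a x y z, q (a *: x + y) z = a * q x z + q y z) ->
  (forall a x y z, q z (a *: x + y) = Num.conj a * q z x + q z y) ->
  (forall x, q x x = 0) -> forall x y, q x y = 0.
Proof.
move=> ql qr q0 x y.
have h a : a * q x y + Num.conj a * q y x = 0.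
  by have := q0 (a *: x + y); rewrite ql !qr !q0 mulr0 add0r addr0.
have h1 := h 1; rewrite rmorph1 !mul1r in h1.
have hi := h 'i; rewrite conjCi mulNr -mulrBr in hi.
have /eqP := hi; rewrite mulf_eq0 (negbTE (neq0Ci _)) /= subr_eq0 => /eqP e.
by move/eqP: h1; rewrite -e -mulr2n mulrn_eq0 => /eqP.
Qed.

Lemma positive_selfadjoint V (T : V -> V) : positive_op T -> adjoint T T.
Proof.
move=> [[lT _] pT] x y; apply/eqP; rewrite -subr_eq0; apply/eqP.
apply: (@polarization _ (fun x y => '[T x, y] - '[x, T y])) => {x y} [a x y z|a x y z|x].
- by rewrite lT !innerDl !innerZl; ring.
- by rewrite lT !innerDr !innerZr; ring.
- by rewrite (innerC x) conj_Creal ?subrr // ger0_real.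
Qed.

Lemma isometry_inner V W (J : V -> W) : isometric_op J ->
  forall x y, '[J x, J y] = '[x, y].
Proof.
move=> iJ x y; apply/eqP; rewrite -subr_eq0; apply/eqP.
have lJ := proj1 iJ.
apply: (@polarization _ (fun x y => '[J x, J y] - '[x, y])) => {x y} [a x y z|a x y z|x].
- by rewrite lJ !innerDl !innerZl; ring.
- by rewrite lJ !innerDr !innerZr; ring.
- by rewrite !innerE (isometry_nrm iJ) subrr.
Qed.

Lemma adjoint_sym V (T T' : V -> V) : adjoint T T' -> adjoint T' T.
Proof. by move=> h x y; rewrite innerC -h -innerC. Qed.

Lemma inner_eq V (x y : V) : (forall z, '[z, x] = '[z, y]) -> x = y.
Proof.
move=> h; apply/eqP; rewrite -subr_eq0; apply/eqP/inner_eq0.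
by rewrite innerBr h subrr.
Qed.

Lemma adjoint_linear V (T T' : V -> V) : adjoint T T' -> linear T'.
Proof.
move=> h a x y; apply: inner_eq => z.
by rewrite -h !innerDr !innerZr !h.
Qed.

Lemma adjoint_bop V (T T' : V -> V) c :
  0 <= c -> bop c T -> adjoint T T' -> bop c T'.
Proof.
move=> c0 [lT hT] h; split=> [|x]; first exact: adjoint_linear h.
have [->|x0] := eqVneq (nrm (T' x)) 0; first by rewrite mulr_ge0.
have xp : 0 < nrm (T' x) by rewrite lt0r x0 nrm_ge0.
rewrite -(ler_pM2l xp) -expr2.
have <- : cabs '[T (T' x), x] = nrm (T' x) ^+ 2.
  by rewrite h innerE cabsR // sqr_ge0.
rewrite (le_trans (cauchy_schwarz _ _)) // mulrA [X in _ <= X * _]mulrC.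
exact: ler_wpM2r.
Qed.

Lemma adjoint_bounded V (T T' : V -> V) :
  bounded_op T -> adjoint T T' -> bounded_op T'.
Proof.
by move=> /bounded_opP[c c0 hT] h; apply: (bop_bounded c0 (adjoint_bop c0 hT h)).
Qed.

Lemma adjoint_opnorm V (T T' : V -> V) :
  bounded_op T -> adjoint T T' -> opnorm T' <= opnorm T.
Proof.
move=> bT h; apply: opnorm_le; first exact: opnorm_ge0.
exact: adjoint_bop (opnorm_ge0 bT) (opnorm_bop bT) h.
Qed.

Lemma adjoint_lin V (S S' T T' : V -> V) a :
  adjoint S S' -> adjoint T T' -> adjoint (a *: S + T) (Num.conj a *: S' + T').
Proof.
move=> hS hT x y.
rewrite [(a *: S + T) x](_ : _ = a *: S x + T x) //.
rewrite [(Num.conj a *: S' + T') y](_ : _ = Num.conj a *: S' y + T' y) //.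
by rewrite innerDl innerDr innerZl innerZr conjCK hS hT.
Qed.

Lemma adjointB V (S S' T T' : V -> V) :
  adjoint S S' -> adjoint T T' -> adjoint (S - T) (S' - T').
Proof.
move=> hS hT; have := adjoint_lin (-1) hT hS.
by rewrite rmorphN rmorph1 !scaleN1r addrC [- T' + S']addrC.
Qed.

Lemma adjoint_comp V (S S' T T' : V -> V) :
  adjoint S S' -> adjoint T T' -> adjoint (S \o T) (T' \o S').
Proof. by move=> hS hT x y /=; rewrite hS hT. Qed.

Lemma cabs_small a c : (forall e : R, 0 < e -> cabs a <= c * e) -> a = 0.
Proof.
move=> h; apply: cabs_eq0; apply/ler_addgt0Pl => e e0; rewrite addr0.
have c0 : 0 <= c by have := h 1 ltr01; rewrite mulr1; apply: le_trans.
apply: (le_trans (h (e / (1 + c)) _)); first by rewrite divr_gt0 // ltr_pwDl.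
rewrite mulrA ler_pdivrMr ?ltr_pwDl // mulrDr mulr1 [e * c]mulrC lerDr.
exact: ltW.
Qed.

Lemma half_adjoint_dense V (T : V -> V) (D : set V) u w :
  bounded_op T -> dense_in D -> (forall x, D x -> '[T x, u] = '[x, w]) ->
  forall x, '[T x, u] = '[x, w].
Proof.
move=> /bounded_opP[c c0 [lT hT]] dD h x; apply/eqP; rewrite -subr_eq0; apply/eqP.
apply: (@cabs_small _ (c * nrm u + nrm w)) => e e0.
have [y Dy xy] := dD x e e0.
have -> : '[T x, u] - '[x, w] = '[T (x - y), u] - '[x - y, w].
  by rewrite (linB lT) !innerBl (h y Dy); ring.
rewrite -(mulN1r '[x - y, w]) (le_trans (ler_cabsD _ _)) // mulrDl lerD //.
  rewrite (le_trans (cauchy_schwarz _ _)) // mulrAC ler_wpM2r //.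
  by rewrite (le_trans (hT _)) // ler_wpM2l // ltW.
rewrite mulN1r /cabs normrN -/(cabs _) (le_trans (cauchy_schwarz _ _)) // mulrC.
by rewrite ler_wpM2l // ltW.
Qed.

Lemma adjoint_dense V (T T' : V -> V) (D : set V) :
  bounded_op T -> bounded_op T' -> dense_in D ->
  (forall x y, D x -> D y -> '[T x, y] = '[x, T' y]) -> adjoint T T'.
Proof.
move=> bT bT' dD h.
have h1 y x : D y -> '[T x, y] = '[x, T' y].
  by move=> Dy; apply: (half_adjoint_dense bT dD) => z Dz; apply: h.
suff h2 : adjoint T' T by apply: adjoint_sym.
move=> y x; apply: (half_adjoint_dense bT' dD) => z Dz.
by rewrite innerC -h1 // -innerC.
Qed.

Lemma cvg_inner_eq V (u v : nat -> V) (x y l l' : V) N :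
  u @ \oo --> l -> v @ \oo --> l' ->
  (forall m, (N <= m)%N -> '[u m, y] = '[x, v m]) -> '[l, y] = '[x, l'].
Proof.
move=> /cvg_nrmP ul /cvg_nrmP vl h; apply/eqP; rewrite -subr_eq0; apply/eqP.
apply: (@cabs_small _ (nrm y + nrm x)) => e e0.
have [N1 h1] := ul e e0; have [N2 h2] := vl e e0.
pose m := maxn N (maxn N1 N2).
have -> : '[l, y] - '[x, l'] = '[l - u m, y] + '[x, v m - l'].
  by rewrite innerBl innerBr h ?leq_maxl //; ring.
rewrite (le_trans (ler_cabsD _ _)) // mulrDl lerD //.
  rewrite (le_trans (cauchy_schwarz _ _)) // mulrC ler_wpM2l // ltW // nrmBC h1 //.
  by rewrite !leq_max leqnn orbT.
rewrite (le_trans (cauchy_schwarz _ _)) // ler_wpM2l // ltW // h2 //.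
by rewrite !leq_max leqnn !orbT.
Qed.

Fixpoint in_span V (s : seq V) (x : V) : Prop :=
  if s is g :: r then exists a y, in_span r y /\ x = a *: g + y else x = 0.

Lemma in_span_lin V (s : seq V) a x y :
  in_span s x -> in_span s y -> in_span s (a *: x + y).
Proof.
elim: s x y => [|g r ih] x y /=; first by move=> -> ->; rewrite scaler0 addr0.
move=> [b [x' [hx ->]]] [b' [y' [hy ->]]].
exists (a * b + b'), (a *: x' + y'); split; first exact: ih.
by rewrite scalerDr scalerA scalerDl addrACA.
Qed.

Lemma in_span0 V (s : seq V) : in_span s 0.
Proof. by elim: s => //= g r ih; exists 0, 0; rewrite scale0r addr0. Qed.

Lemma mem_in_span V (s : seq V) x : x \in s -> in_span s x.
Proof.
elim: s => //= g r ih; rewrite inE => /orP[/eqP ->|/ih hx].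
  by exists 1, 0; rewrite scale1r addr0; split => //; exact: in_span0.
by exists 0, x; rewrite scale0r add0r.
Qed.

(** Adding one vector [g] to the list, the case [S = id] provides the
    projection [P] on the span of the others, so that [g - P g] spans the
    orthogonal complement that is left to be treated. *)
Lemma span_adjoint V (s : seq V) (S : V -> V) : linear S ->
  exists T : V -> V, forall y,
    in_span s (T y) /\ forall x, in_span s x -> '[S x, y] = '[x, T y].
Proof.
elim: s S => [|g r ih] S lS.
  by exists (fun=> 0) => y /=; split=> // x ->; rewrite (lin0 lS) !inner0l.
have [P hP] := ih (@id V) (fun _ _ _ => erefl).
have [T hT] := ih S lS.
pose h := g - P g.
have orth x : in_span r x -> '[x, h] = 0.
  by move=> hx; rewrite innerBr; have [_ <-] := hP g; rewrite ?subrr.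
pose b y := Num.conj '[S h, y] / '[h, h].
exists (fun y => T y + b y *: h) => y; have [Tr hTy] := hT y; split.
  exists (b y), (T y - b y *: P g); split.
    rewrite -[T y]scale1r addrC -scaleNr; apply: in_span_lin; first by case: (hP g).
    by rewrite scale1r.
  by rewrite /h scalerBr addrCA addrA addrC.
have hh : '[S h, y] = '[h, T y + b y *: h].
  rewrite innerDr (innerC h (T y)) orth // rmorph0 add0r innerZr /b.
  have [h0|h0] := eqVneq '[h, h] 0.
    by rewrite (inner_eq0 h0) (lin0 lS) !inner0l; apply/esym/mulr0.
  have chh : Num.conj '[h, h] = '[h, h] by rewrite -innerC.
  by rewrite fmorph_div /= conjCK chh divfK.
move=> x /= [a [z [hz ->]]].
have -> : a *: g + z = a *: h + (a *: P g + z).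
  by rewrite addrA -scalerDr subrK.
have hz' : in_span r (a *: P g + z) by apply: in_span_lin => //; case: (hP g).
move: (a *: P g + z) hz' => w hw.
rewrite (linD lS) (linZ lS) !innerDl !innerZl hh; congr (_ + _).
by rewrite innerDr innerZr orth // mulr0 addr0 hTy.
Qed.

Lemma finite_adjoint V (T : V -> V) : finite_dimensional V -> linear T ->
  exists T' : V -> V, adjoint T T'.
Proof.
move=> [m [e he]] lT.
have [T' hT'] := span_adjoint [seq e k | k <- enum 'I_m] lT.
exists T' => x y; have [_] := hT' y; apply.
have : lin_span (range e) x by rewrite he.
move=> [p [a [v [hv ->]]]]; elim/big_ind: _ => [|z w hz hw|i _].
- exact: in_span0.
- by rewrite -[z]scale1r; apply: in_span_lin.
rewrite -[_ *: _]addr0; apply: in_span_lin (in_span0 _).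
apply: mem_in_span; have [k _ <-] := hv i.
by apply/mapP; exists k => //; rewrite mem_enum.
Qed.

End Adjoint.

Section TensorAdjoint.
Context {R : realType}.

Lemma tensor_op_adjoint (I : finType) (V : I -> hilbertType R) (T : hilbertType R)
    (t : (forall i, V i) -> T) (S S' : forall i, V i -> V i) (F F' : T -> T) :
  is_tensor t -> (forall i, adjoint (S i) (S' i)) ->
  tensor_op t S F -> tensor_op t S' F' -> adjoint F F'.
Proof.
move=> tt hS [bF hF] [bF' hF'].
apply: (adjoint_dense bF bF' (tensor_dense tt)) => _ _ [s _ <-] [s' _ <-].
rewrite (combine_lin _ (proj1 bF)) (combine_lin _ (proj1 bF')).
rewrite /combine !inner_suml; apply: eq_bigr => p _.
rewrite !inner_sumr; apply: eq_bigr => p' _ /=.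
rewrite hF hF' !innerZl !innerZr !(proj1 tt).
by under eq_bigr do rewrite hS.
Qed.

Context {H : nat -> hilbertType R} {xi : forall n, H n} (X : infinite_tensor xi).

Lemma inf_op_adjoint (S S' : forall n, H n -> H n)
    (T T' : lim_tensor X -> lim_tensor X) :
  (forall n, adjoint (S n) (S' n)) ->
  is_inf_tensor_op S T -> is_inf_tensor_op S' T' -> adjoint T T'.
Proof.
move=> hS [bT [F [hF FT]]] [bT' [F' [hF' FT']]].
apply: (adjoint_dense bT bT' (@embed_dense_in _ _ _ X)).
move=> _ _ [n _ [z _ <-]] [p _ [w _ <-]].
apply: (cvg_inner_eq (N := maxn n p) (FT n z) (FT' p w)) => m.
rewrite geq_max => /andP[nm pm].
rewrite -(embed_conn pm w) -(embed_conn nm z).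
rewrite !(isometry_inner (embed_isometric X m)).
exact: (tensor_op_adjoint (elemP X m) (fun i : 'I_m => hS i) (hF m) (hF' m)).
Qed.

End TensorAdjoint.

(** * Norm closures of algebras of operators *)

Section NormClosure.
Context {R : realType} {V : hilbertType R}.
Implicit Types (A B G : set (V -> V)) (T U : V -> V).

Lemma opnorm_lt (W Z : hilbertType R) (T U : W -> Z) (e : R) :
  T = U -> 0 < e -> opnorm (T - U) < e.
Proof.
by move=> -> e0; apply: le_lt_trans e0; exact: opnormBB.
Qed.

Lemma sub_norm_closure A :
  (forall T, A T -> bounded_op T) -> A `<=` norm_closure A.
Proof.
by move=> bA T AT; split=> [|e /opnorm_lt h]; [exact: bA|exists T; rewrite ?h].
Qed.

Lemma norm_closureS A B : A `<=` B -> norm_closure A `<=` norm_closure B.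
Proof.
move=> AB T [bT hT]; split=> // e /hT[U /AB BU TU].
by exists U.
Qed.

Lemma norm_closure_idem A : (forall T, A T -> bounded_op T) ->
  norm_closure (norm_closure A) `<=` norm_closure A.
Proof.
move=> bA T [bT hT]; split=> // e e0.
have e20 : 0 < e / 2 by rewrite divr_gt0.
have [U [bU hU] TU] := hT _ e20; have [W AW UW] := hU _ e20.
exists W => //; have := opnorm_dist3 bT bU (bA _ AW).
by move=> h; lra.
Qed.

Lemma norm_closure_subalgebra A : subalgebra A -> subalgebra (norm_closure A).
Proof.
move=> [bA A0 Alin Acomp]; split=> [T []//||a T U [bT hT] [bU hU]|T U [bT hT] [bU hU]].
- exact: sub_norm_closure.
- split=> [|e e0]; first exact: bounded_lin.
  pose e' := e / (1 + cabs a).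
  have a1 : 0 < 1 + cabs a by rewrite ltr_pwDl.
  have e'0 : 0 < e' by rewrite divr_gt0.
  have [T1 AT1 h1] := hT _ e'0; have [U1 AU1 h2] := hU _ e'0.
  exists (a *: T1 + U1); first exact: Alin.
  have -> : a *: T + U - (a *: T1 + U1) = a *: (T - T1) + (U - U1).
    by rewrite opprD addrACA scalerBr.
  have bT1 := boundedB bT (bA _ AT1); have bU1 := boundedB bU (bA _ AU1).
  apply: (@le_lt_trans _ _ (cabs a * opnorm (T - T1) + opnorm (U - U1))).
    apply: opnorm_le; first by rewrite addr_ge0 ?mulr_ge0 ?opnorm_ge0.
    by apply: bop_lin; exact: opnorm_bop.
  have -> : e = cabs a * e' + e' by rewrite /e'; field; rewrite gt_eqF.
  by rewrite ler_ltD // ler_wpM2l // ltW.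
- split=> [|e e0]; first exact: bounded_comp.
  pose d := opnorm T + opnorm U + 2.
  have nT0 := opnorm_ge0 bT; have nU0 := opnorm_ge0 bU.
  have d0 : 0 < d by rewrite /d; lra.
  (* The minimum with [1] keeps [opnorm U1] below [opnorm U + 1]. *)
  pose e' := Num.min 1 (e / d).
  have e'0 : 0 < e' by rewrite lt_min ltr01 divr_gt0.
  have e'1 : e' <= 1 by rewrite ge_min lexx.
  have [T1 AT1 h1] := hT _ e'0; have [U1 AU1 h2] := hU _ e'0.
  exists (T1 \o U1); first exact: Acomp.
  have bT1 := boundedB bT (bA _ AT1); have bU1 := boundedB bU (bA _ AU1).
  have E : (T \o U) - (T1 \o U1) = 1 *: (T \o (U - U1)) + ((T - T1) \o U1).
    apply/funext => x; rewrite scale1r.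
    rewrite [LHS](_ : _ = T (U x) - T1 (U1 x)) //.
    rewrite [RHS](_ : _ = T (U x - U1 x) + (T (U1 x) - T1 (U1 x))) //.
    by rewrite (linB (proj1 bT)) addrA subrK.
  have n1 := opnorm_ge0 bT1; have n2 := opnorm_ge0 bU1.
  have bU' := bA _ AU1; have n3 := opnorm_ge0 bU'.
  have n4 : opnorm U1 <= opnorm U + 1.
    have := opnormD (boundedB (bA _ AU1) bU) bU.
    by rewrite subrK (opnormBC (bA _ AU1) bU) => h; lra.
  rewrite E; apply: (@le_lt_trans _ _
      (cabs 1 * (opnorm T * opnorm (U - U1)) + opnorm (T - T1) * opnorm U1)).
    apply: opnorm_le; first by rewrite addr_ge0 ?mulr_ge0.
    by apply: bop_lin; apply: bop_comp => //; exact: opnorm_bop.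
  rewrite /cabs normr1 mul1r.
  have e'd : e' <= e / d by rewrite ge_min lexx orbT.
  have ed : e' * d <= e by rewrite -ler_pdivlMr.
  have k1 : opnorm T * opnorm (U - U1) <= opnorm T * e'.
    by rewrite ler_wpM2l // ltW.
  have k2 : opnorm (T - T1) * opnorm U1 <= e' * (opnorm U + 1).
    by apply: ler_pM => //; rewrite ltW.
  rewrite /d in ed; nra.
Qed.


Lemma norm_closure_cstar A : subalgebra A ->
  (forall T, A T -> exists2 T', adjoint T T' & norm_closure A T') ->
  cstar_subalgebra (norm_closure A).
Proof.
move=> sA hA; have [bA _ _ _] := sA; split.
- exact: norm_closure_subalgebra.
- move=> T T' [bT hT] bT' TT'; apply: (norm_closure_idem bA); split=> // e e0.
  have [U AU TU] := hT e e0; have [U' UU' AU'] := hA U AU.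
  exists U' => //; apply: le_lt_trans TU.
  exact: adjoint_opnorm (boundedB bT (bA _ AU)) (adjointB TT' UU').
- exact: norm_closure_idem.
Qed.

Lemma all_bounded_cstar : cstar_subalgebra [set T : V -> V | bounded_op T].
Proof.
split=> [|T T' _ bT' _ //|T []//].
split=> //=; first exact: bounded0.
- by move=> a T U; apply: bounded_lin.
- by move=> T U; apply: bounded_comp.
Qed.

(** Both kinds of algebras are stable under intersections.  That the elements
    of the smallest one are bounded comes from comparing it with the algebra
    of all bounded operators, which contains [G]. *)
Lemma smallest_subalgebra G : (forall T, G T -> bounded_op T) ->
  subalgebra (smallest (@subalgebra R V) G).
Proof.
move=> bG; split.
- by move=> T; apply; split=> //; have [] := all_bounded_cstar.
- by move=> B [[]].
- move=> a T U hT hU B [sB GB]; have [_ _ lin _] := sB.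
  by apply: lin; [apply: hT|apply: hU].
- move=> T U hT hU B [sB GB]; have [_ _ _ comp] := sB.
  by apply: comp; [apply: hT|apply: hU].
Qed.

Lemma smallest_cstar G : (forall T, G T -> bounded_op T) ->
  cstar_subalgebra (smallest (@cstar_subalgebra R V) G).
Proof.
move=> bG; split; first split.
- by move=> T; apply; split=> //; exact: all_bounded_cstar.
- by move=> B [[[]]].
- move=> a T U hT hU B [sB GB]; have [[_ _ lin _] _ _] := sB.
  by apply: lin; [apply: hT|apply: hU].
- move=> T U hT hU B [sB GB]; have [[_ _ _ comp] _ _] := sB.
  by apply: comp; [apply: hT|apply: hU].
- move=> T T' hT bT' TT' B [sB GB]; have [_ adj _] := sB.
  by apply: adj TT' => //; apply: hT.
- move=> T hT B [sB GB]; have [_ _ cl] := sB; apply: cl.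
  by apply: norm_closureS hT => U; apply.
Qed.

End NormClosure.

Section FrakNC.
Context {R : realType} {H : nat -> hilbertType R} {xi : forall n, H n}.
Context (xi_unit : forall n, `|xi n| = 1) (X : infinite_tensor xi).
Context (H_fin : forall n, finite_dimensional (H n)).
Context (A M : forall n, H n -> H n).
Arguments A n _ : clear implicits.
Arguments M n _ : clear implicits.
Context (A_bounded : forall n, bounded_op (A n)).
Context (A_norm : forall n, opnorm (A n) = 1).
Context (A_xi : forall n, A n (xi n) = xi n).
Context (A_sa : forall n, adjoint (A n) (A n)).
Context (nM : summably_close A M).

Lemma eventually_bounded (B : forall n, H n -> H n) T :
  eventually_tensor (X := X) B T -> bounded_op T.
Proof. by move=> [S [_ _ [bT _]]]. Qed.

Lemma close_adjoint (S S' : forall n, H n -> H n) : summably_close A S ->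
  (forall n, adjoint (S n) (S' n)) -> summably_close A S'.
Proof.
move=> [bS cS] hS.
have bS' n : bounded_op (S' n) := adjoint_bounded (bS n) (hS n).
split=> //; apply: (summable_dom (k := 0) _ _ _ cS) => n.
- by apply/opnorm_ge0/boundedB.
- by apply/opnorm_ge0/boundedB.
- move=> _; apply: adjoint_opnorm; first exact: boundedB.
  exact: adjointB.
Qed.

Lemma frakN_subalgebra : subalgebra (frakN X M).
Proof. by apply: smallest_subalgebra => T /eventually_bounded. Qed.

Lemma frakC_cstar : cstar_subalgebra (frakC X A).
Proof. by apply: smallest_cstar => T /eventually_bounded. Qed.

Let approx := close_approx xi_unit A_bounded A_norm A_xi (X := X).
Let nA := close_refl A_bounded.

Lemma frakN_sub_frakC : frakN X M `<=` frakC X A.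
Proof.
have [sC _ clC] := frakC_cstar.
move=> T; apply; split=> // {}T /(approx nM nA) hT.
by apply: clC; apply: norm_closureS hT => U hU B [_]; apply.
Qed.

(** The adjoint of a tensor product with tail [M] has the tail [M^*], which
    is as close to the self-adjoint [A] as [M] is. *)
Lemma eventually_adjoint T : eventually_tensor (X := X) M T ->
  exists2 T', adjoint T T' & norm_closure (frakN X M) T'.
Proof.
move=> [S [[bS _ _] [k SM] ST]].
have hadj n : exists adj : (H n -> H n) -> H n -> H n,
    forall U, bounded_op U -> adjoint U (adj U).
  suff h (U : H n -> H n) : exists U', bounded_op U -> adjoint U U'.
    by have [adj hadj] := choice h; exists adj.
  have [bU|nbU] := EM (bounded_op U); last by exists U.
  by have [U' UU'] := finite_adjoint (H_fin n) (proj1 bU); exists U'.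
pose adj n := projT1 (cid (hadj n)).
have adjP n U : bounded_op U -> adjoint U (adj n U).
  by rewrite /adj; case: cid => a ha; apply: ha.
have nS := close_tail A_bounded nM bS SM.
have nS' : summably_close A (fun n => adj n (S n)) :=
  close_adjoint nS (fun n => adjP n _ (bS n)).
have nM' : summably_close A (fun n => adj n (M n)).
  by apply: close_adjoint nM (fun n => adjP n _ _); case: nM.
have [T' hT'] := close_inf_op xi_unit X A_bounded A_norm A_xi nS'.
exists T'; first exact: inf_op_adjoint (fun n => adjP n _ (bS n)) ST hT'.
apply: (norm_closureS (A := eventually_tensor (X := X) M)) => [U hU B [_]|]; first exact.
apply: (approx nM' nM); exists (fun n => adj n (S n)); split=> //.
  exact: close_admissible nS'.
by exists k => n /SM ->.
Qed.

(** The operators that satisfy the conclusion form a subalgebra, so that the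
    generators suffice. *)
Lemma frakN_adjoint T : frakN X M T ->
  exists2 T', adjoint T T' & norm_closure (frakN X M) T'.
Proof.
have [bN N0 Nlin Ncomp] := frakN_subalgebra.
have [bC C0 Clin Ccomp] := norm_closure_subalgebra frakN_subalgebra.
pose B T := frakN X M T /\ exists2 T', adjoint T T' & norm_closure (frakN X M) T'.
suff sB : subalgebra B.
  move=> hT; suff [] : B T by [].
  apply: hT; split=> // U hU; split; last exact: eventually_adjoint.
  by move=> D [_]; apply.
split.
- by move=> U [/bN].
- by split=> //; exists 0 => // x y; rewrite inner0l inner0r.
- move=> a U W [NU [U' UU' CU']] [NW [W' WW' CW']]; split; first exact: Nlin.
  exists (Num.conj a *: U' + W'); last exact: Clin.
  exact: adjoint_lin.
- move=> U W [NU [U' UU' CU']] [NW [W' WW' CW']]; split; first exact: Ncomp.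
  by exists (W' \o U'); [exact: adjoint_comp|exact: Ccomp].
Qed.

Lemma frakC_sub_closure : frakC X A `<=` norm_closure (frakN X M).
Proof.
move=> T; apply; split.
  exact: norm_closure_cstar frakN_subalgebra frakN_adjoint.
move=> U /(approx nA nM); apply: norm_closureS => W hW B [_]; exact.
Qed.

End FrakNC.

(** * Linear spans of sets of operators *)

Section OpSpan.
Context {R : realType} {V : hilbertType R}.
Implicit Types (G : set (V -> V)) (T U : V -> V) (a b : R[i]).

Inductive op_span G : (V -> V) -> Prop :=
| op_span0 : op_span G 0
| op_span_cons a T U : G T -> op_span G U -> op_span G (a *: T + U).

Lemma op_span_in G : G `<=` op_span G.
Proof.
by move=> T GT; rewrite -[T]scale1r -[_ *: _]addr0; exact: op_span_cons (op_span0 _).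
Qed.

Lemma op_span_lin G a T U : op_span G T -> op_span G U -> op_span G (a *: T + U).
Proof.
move=> hT hU; elim: hT => [|b T1 T2 G1 _ ih]; first by rewrite scaler0 add0r.
by rewrite scalerDr scalerA -addrA; apply: op_span_cons.
Qed.

Lemma op_span_sub G (B : set (V -> V)) : B 0 ->
  (forall a T U, B T -> B U -> B (a *: T + U)) -> G `<=` B -> op_span G `<=` B.
Proof. by move=> B0 Blin GB T hT; elim: hT => // a T1 T2 /GB G1 _ ih; apply: Blin. Qed.

Lemma op_spanS G G' : G `<=` G' -> op_span G `<=` op_span G'.
Proof.
move=> GG'; apply: op_span_sub; first exact: op_span0.
  by move=> a T U; apply: op_span_lin.
exact: subset_trans GG' (@op_span_in G').
Qed.

Lemma op_span_bounded G : (forall T, G T -> bounded_op T) ->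
  forall T, op_span G T -> bounded_op T.
Proof.
move=> bG; apply: op_span_sub => //; first exact: bounded0.
by move=> a T U; apply: bounded_lin.
Qed.

Lemma op_span_comp G G' G'' : (forall T, G T -> bounded_op T) ->
  (forall T U, G T -> G' U -> G'' (T \o U)) ->
  forall T U, op_span G T -> op_span G' U -> op_span G'' (T \o U).
Proof.
move=> bG GG' T U hT hU; elim: hT => [|a T1 T2 G1 _ ih]; first exact: op_span0.
rewrite (_ : (a *: T1 + T2) \o U = a *: (T1 \o U) + (T2 \o U)) //.
apply: op_span_lin ih; have [l1 _] := bG _ G1.
elim: hU => [|b U1 U2 G'1 _ ih].
  rewrite (_ : T1 \o 0 = 0); first exact: op_span0.
  by apply/funext => x /=; exact: lin0.
rewrite (_ : T1 \o (b *: U1 + U2) = b *: (T1 \o U1) + (T1 \o U2)).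
  by apply: op_span_cons ih; apply: GG'.
by apply/funext => x; exact: l1.
Qed.

End OpSpan.

Section Odot.
Context {R : realType} {V W P : hilbertType R} (t : V -> W -> P).
Context (t_tensor : is_tensor2 t).
Implicit Types (A : set (V -> V)) (B : set (W -> W)).

Definition elementary A B : set (P -> P) :=
  [set U | exists F G, [/\ A F, B G & is_tensor2_op t F G U]].

Lemma odot_op_span A B : odot t A B `<=` op_span (elementary A B).
Proof.
move=> T [m [F [G [U [hU ->]]]]]; elim/big_ind: _ => [|S S' hS hS'|j _].
- exact: op_span0.
- by rewrite -[S]scale1r; apply: op_span_lin.
- by apply: op_span_in; exists (F j), (G j).
Qed.

(** The scalars of the span are absorbed by the second tensor factor. *)
Lemma op_span_odot A B : (forall a G, B G -> B (a *: G)) ->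
  op_span (elementary A B) `<=` odot t A B.
Proof.
move=> BZ T hT; elim: hT => [|a U S [F0 [G0 [AF BG hU]]] _ [m [F [G [Us [hUs ->]]]]]].
  exists 0%N, (fun=> 0), (fun=> 0), (fun=> 0); rewrite big_ord0.
  by split=> // -[].
pose cons Y (x : Y) (f : 'I_m -> Y) (j : 'I_m.+1) :=
  if unlift ord0 j is Some i then f i else x.
exists m.+1, (cons _ F0 F), (cons _ (a *: G0) G), (cons _ (a *: U) Us); split.
  move=> j; rewrite /cons; case: unliftP => [i _|_]; first exact: hUs.
  split=> //; first exact: BZ.
  have [bU hU'] := hU; split.
    by have := bounded_lin a bU (bounded0 P P); rewrite addr0.
  move=> x y; rewrite [LHS](_ : _ = a *: U (t x y)) // hU'.
  have := tensor2_linr t_tensor a (F0 x) (G0 y) 0.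
  by rewrite (tensor2_0r t_tensor) !addr0 => ->.
rewrite big_ord_recl; congr (_ + _); first by rewrite /cons unlift_none.
by apply: eq_bigr => i _; rewrite /cons liftK.
Qed.

Lemma elementary_bounded A B U : elementary A B U -> bounded_op U.
Proof. by move=> [F [G [_ _ []]]]. Qed.

Lemma elementary_comp A A' A'' B B' B'' :
  (forall F F', A F -> A' F' -> A'' (F \o F')) ->
  (forall G G', B G -> B' G' -> B'' (G \o G')) ->
  forall U U', elementary A B U -> elementary A' B' U' ->
    elementary A'' B'' (U \o U').
Proof.
move=> hA hB U U' [F [G [AF BG [bU hU]]]] [F' [G' [AF' BG' [bU' hU']]]].
exists (F \o F'), (G \o G'); split; [exact: hA|exact: hB|].
split; first exact: bounded_comp.
by move=> x y /=; rewrite hU' hU.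
Qed.

Lemma elementaryS A A' B B' : A `<=` A' -> B `<=` B' ->
  elementary A B `<=` elementary A' B'.
Proof. by move=> AA' BB' U [F [G [/AA' hF /BB' hG hU]]]; exists F, G. Qed.

Lemma odot_subalgebra A B : (forall F F', A F -> A F' -> A (F \o F')) ->
  subalgebra B -> subalgebra (odot t A B).
Proof.
move=> hA [_ B0 Blin Bcomp].
have BZ a G : B G -> B (a *: G) by move=> BG; rewrite -[_ *: _]addr0; apply: Blin.
split.
- move=> T /odot_op_span; apply: op_span_bounded => U; exact: elementary_bounded.
- exact: (op_span_odot BZ (op_span0 _)).
- move=> a T U /odot_op_span hT /odot_op_span hU.
  exact: (op_span_odot BZ (op_span_lin a hT hU)).
- move=> T U /odot_op_span hT /odot_op_span hU; apply: (op_span_odot BZ).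
  apply: op_span_comp hT hU; first by move=> S; exact: elementary_bounded.
  exact: elementary_comp.
Qed.

Lemma odotS A B B' : B `<=` B' -> odot t A B `<=` odot t A B'.
Proof.
move=> BB' T [m [F [G [U [hU ->]]]]]; exists m, F, G, U; split=> // j.
by have [hF hG h] := hU j; split=> //; apply: BB'.
Qed.

(** The norm of [F (x) G] is at most the product of the norms, so that
    approximating [G] approximates [F (x) G]. *)
Lemma odot_approx A B B' : (forall F, A F -> bounded_op F) ->
  (forall F F', A F -> A F' -> A (F \o F')) -> subalgebra B ->
  B' `<=` norm_closure B -> odot t A B' `<=` norm_closure (odot t A B).
Proof.
move=> bA Acomp sB B'B; have [bB B0 Blin _] := sB.
have [_ C0 Clin _] := norm_closure_subalgebra (odot_subalgebra Acomp sB).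
have BZ a G : B G -> B (a *: G) by move=> BG; rewrite -[_ *: _]addr0; apply: Blin.
apply: (subset_trans (@odot_op_span A B')); apply: op_span_sub => // U.
move=> [F [G [AF /B'B[bG hG] hU]]]; have bF := bA _ AF.
split; first by case: hU.
move=> e e0; pose e' := e / (1 + opnorm F).
have F1 : 0 < 1 + opnorm F by rewrite ltr_pwDl // opnorm_ge0.
have e'0 : 0 < e' by rewrite divr_gt0.
have [N BN GN] := hG e' e'0; have bN := bB _ BN.
have [U' _ hU'] := tensor2_opP t_tensor (opnorm_ge0 bF) (opnorm_ge0 bN)
  (opnorm_bop bF) (opnorm_bop bN).
exists U'; first by apply: (op_span_odot BZ); apply: op_span_in; exists F, N.
have bGN := boundedB bG bN.
have [D bD hD] := tensor2_opP t_tensor (opnorm_ge0 bF) (opnorm_ge0 bGN)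
  (opnorm_bop bF) (opnorm_bop bGN).
have -> : U - U' = D.
  apply: (tensor2_op_uniq t_tensor _ hD); split.
    by apply: boundedB; [case: hU|case: hU'].
  move=> x y; rewrite [LHS](_ : _ = U (t x y) - U' (t x y)) //.
  rewrite (proj2 hU) (proj2 hU').
  have := tensor2_linr t_tensor (-1) (F x) (N y) (G y).
  by rewrite !scaleN1r ![- _ + _]addrC => ->.
apply: (@le_lt_trans _ _ (opnorm F * opnorm (G - N))).
  by apply: opnorm_le => //; rewrite mulr_ge0 ?opnorm_ge0.
have -> : e = opnorm F * e' + e' by rewrite /e'; field; rewrite gt_eqF.
apply: (@le_lt_trans _ _ (opnorm F * e')); last by rewrite ltrDl.
by rewrite ler_wpM2l ?opnorm_ge0 // ltW.
Qed.

End Odot.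

(** * Nilpotency *)

Section Nilpotent.
Context {R : realType} {H : nat -> hilbertType R} {xi : forall n, H n}.
Context (xi_unit : forall n, `|xi n| = 1) (X : infinite_tensor xi).
Context (M : forall n, H n -> H n) (M_bounded : forall n, bounded_op (M n)).
Arguments M n _ : clear implicits.
Implicit Types (T : lim_tensor X -> lim_tensor X).

(** The tensor products with a power of [M n] of exponent at least [q] at every
    position [n] from [k] on.  Asking for all of these positions makes the
    sets increase with [k], so that finitely many operators have a common [k],
    and the lower bound on the exponents makes them decrease with [q].  The
    uniform bound [P] is there for compositions. *)
Definition power_tail k q : set (lim_tensor X -> lim_tensor X) :=
  [set T | bounded_op T /\ exists (S : forall n, H n -> H n) (P : R)
       (F : forall m, fin_tensor X m -> fin_tensor X m),
     [/\ 0 <= P,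
         forall m, is_fin_tensor_op S (F m),
         forall m, bop P (F m),
         forall n (z : fin_tensor X n),
           embed (F m (conn m z)) @[m --> \oo] --> T (embed z)
       & forall n, (k <= n)%N ->
           exists2 r, (q <= r)%N & forall x, S n x = iter r (M n) x]].


(** The argument of [F m] varies with [m].  It is compared with its value at a
    fixed level [m0], where the convergence to [T] applies; the uniform bound
    on the [F m] controls the difference. *)
Lemma inf_op_comp_lim (F F' : forall m, fin_tensor X m -> fin_tensor X m) T T' P :
  0 <= P -> bounded_op T -> (forall m, bop P (F m)) ->
  (forall n (z : fin_tensor X n),
     embed (F m (conn m z)) @[m --> \oo] --> T (embed z)) ->
  (forall n (z : fin_tensor X n),
     embed (F' m (conn m z)) @[m --> \oo] --> T' (embed z)) ->
  forall n (z : fin_tensor X n),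
     embed (F m (F' m (conn m z))) @[m --> \oo] --> T (T' (embed z)).
Proof.
move=> P0 /bounded_opP[c c0 [lT hT]] bF FT FT' n z; apply/cvg_nrmP => e e0.
pose d := e / (2 * P + 2 + c).
have C0 : 0 < 2 * P + 2 + c by lra.
have d0 : 0 < d by rewrite divr_gt0.
pose v m := embed (F' m (conn m z)).
have [N1 h1] := proj1 (cvg_nrmP v _) (FT' n z) d d0.
pose m0 := maxn N1 n; pose w := F' m0 (conn m0 z).
have [N2 h2] := proj1 (cvg_nrmP _ _) (FT m0 w) d d0.
exists (maxn m0 N2) => m; rewrite geq_max => /andP[m0m N2m].
have k1 := h1 m (leq_trans (leq_maxl _ _) m0m).
have k2 := h2 m N2m.
have k3 := h1 m0 (leq_maxl _ _).
have k4 : nrm (embed (F m (F' m (conn m z))) - embed (F m (conn m w))) <= P * (d + d).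
  have lE := proj1 (embed_isometric X m).
  rewrite -(linB lE) (isometry_nrm (embed_isometric X m)) -(linB (proj1 (bF m))).
  apply: (le_trans (proj2 (bF m) _)); apply: ler_wpM2l => //.
  rewrite -(isometry_nrm (embed_isometric X m)) (linB lE) embed_conn //.
  apply: (le_trans (ler_dist3 _ (T' (embed z)) _)).
  by rewrite (nrmBC (T' _)) lerD // ltW.
have k5 : nrm (T (embed w) - T (T' (embed z))) <= c * d.
  by rewrite -(linB lT) (le_trans (hT _)) // ler_wpM2l // ltW.
have t1 := ler_dist3 (embed (F m (F' m (conn m z)))) (embed (F m (conn m w)))
  (T (T' (embed z))).
have t2 := ler_dist3 (embed (F m (conn m w))) (T (embed w)) (T (T' (embed z))).
have ed : e = P * (d + d) + 2 * d + c * d by rewrite /d; field; rewrite gt_eqF.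
by rewrite ed; lra.
Qed.

Lemma power_tail_comp k q q' T T' : power_tail k q T -> power_tail k q' T' ->
  power_tail k (q + q') (T \o T').
Proof.
move=> [bT [S [P [F [P0 hF bF FT hS]]]]] [bT' [S' [P' [F' [P'0 hF' bF' FT' hS']]]]].
split; first exact: bounded_comp.
exists (fun n => S n \o S' n), (P * P'), (fun m => F m \o F' m); split.
- exact: mulr_ge0.
- move=> m; split; first by apply: bounded_comp; [case: (hF m)|case: (hF' m)].
  by move=> eta /=; rewrite (proj2 (hF' m)) (proj2 (hF m)).
- by move=> m; apply: bop_comp.
- exact: inf_op_comp_lim bT bF FT FT'.
- move=> n kn; have [r qr hr] := hS n kn; have [r' qr' hr'] := hS' n kn.
  exists (r + r')%N; first exact: leq_add.
  by move=> x /=; rewrite hr' hr iterD.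
Qed.

Lemma power_tailS k k' q q' : (k <= k')%N -> (q' <= q)%N ->
  power_tail k q `<=` power_tail k' q'.
Proof.
move=> kk' qq' T [bT [S [P [F [P0 hF bF FT hS]]]]]; split=> //.
exists S, P, F; split=> // n k'n; have [r qr hr] := hS n (leq_trans kk' k'n).
by exists r => //; exact: leq_trans qr.
Qed.

(** Once the power reaches the nilpotency index of [M k], all of the words
    have a zero factor at the position [k]. *)
Lemma power_tail_nilpotent k q T :
  (forall x, iter q (M k) x = 0) -> power_tail k q T -> T = 0.
Proof.
move=> Mq [bT [S [P [F [P0 hF bF FT hS]]]]].
have [r qr hr] := hS k (leqnn k).
have Sk x : S k x = 0.
  rewrite hr -(subnK qr) iterD Mq; elim: (r - q)%N => //= i ->.
  exact: lin0 (proj1 (M_bounded k)).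
apply: (eq_dense bT (bounded0 _ _) (@embed_dense_in _ _ _ X)).
move=> _ [n _ [z _ <-]]; apply: nrm_le0.
apply: (cvg_nrm_le (N := k.+1) (FT n z)) => m km.
have -> : F m = 0.
  apply: (dense_combine_eq (proj1 (hF m)) (bounded0 _ _) (tensor_dense (elemP X m))).
  move=> eta; rewrite (proj2 (hF m)).
  by apply: (@tensor_eq0 _ _ _ _ _ (elemP X m) _ (Ordinal km)); exact: Sk.
by rewrite (lin0 (proj1 (embed_isometric X m))) nrm0.
Qed.

Context (A : forall n, H n -> H n).
Arguments A n _ : clear implicits.
Context (A_bounded : forall n, bounded_op (A n)).
Context (A_norm : forall n, opnorm (A n) = 1).
Context (nM : summably_close A M).

Lemma eventually_power_tail T : eventually_tensor (X := X) M T ->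
  exists k, power_tail k 1 T.
Proof.
move=> [S [[bS _ _] [k SM] [bT [F [hF FT]]]]]; exists k; split=> //.
have [P P1 hP] := close_bounded A_bounded A_norm (close_tail A_bounded nM bS SM).
exists S, P, F; split=> // [|m|n kn].
- exact: le_trans P1.
- by apply: bopW (hP m) _; apply: fin_op_bop.
- by exists 1%N => // x; rewrite SM.
Qed.

Lemma power_tail_bounded k q T : power_tail k q T -> bounded_op T.
Proof. by case. Qed.

Lemma power_span_comp k q q' T U :
  op_span (power_tail k q) T -> op_span (power_tail k q') U ->
  op_span (power_tail k (q + q')) (T \o U).
Proof.
apply: op_span_comp; first by move=> S; exact: power_tail_bounded.
by move=> S S'; exact: power_tail_comp.
Qed.

Lemma frakN_power_tail T : frakN X M T ->
  exists k, op_span (power_tail k 1) T.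
Proof.
pose B T := exists k, op_span (power_tail k 1) T.
have mono k k' : (k <= k')%N ->
    op_span (power_tail k 1) `<=` op_span (power_tail k' 1).
  by move=> kk'; apply/op_spanS/power_tailS.
suff sB : subalgebra B.
  move=> hT; suff : B T by [].
  apply: hT; split=> // U /eventually_power_tail[k hU].
  by exists k; apply: op_span_in.
split.
- move=> U [k]; apply: op_span_bounded => S; exact: power_tail_bounded.
- by exists 0%N; exact: op_span0.
- move=> a U V [k hU] [k' hV]; exists (maxn k k'); apply: op_span_lin.
    exact: mono (leq_maxl _ _) _ hU.
  exact: mono (leq_maxr _ _) _ hV.
- move=> U V [k hU] [k' hV]; exists (maxn k k').
  apply: (@op_spanS _ _ (power_tail (maxn k k') 2)); first exact: power_tailS.
  apply: (power_span_comp (q := 1) (q' := 1)).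
    exact: mono (leq_maxl _ _) _ hU.
  exact: mono (leq_maxr _ _) _ hV.
Qed.

(** A word of length [q] in the summands of [Y] acts on the second factor by
    an element of the [q]-th power of the span of finitely many tensor
    products, whatever it does on the first one. *)
Lemma odot_nilpotent (L Q : hilbertType R) (t : L -> lim_tensor X -> Q)
    (B : set (L -> L)) :
  is_tensor2 t -> (forall n, nilpotent_op (M n)) ->
  (forall F, B F -> bounded_op F) ->
  forall Y, odot t B (frakN X M) Y -> nilpotent_op Y.
Proof.
move=> tt Mnil bB Y hY.
pose E k q := op_span (elementary t (@bounded_op R L L) (op_span (power_tail k q))).
have mono k k' : (k <= k')%N -> E k 1%N `<=` E k' 1%N.
  by move=> kk'; apply/op_spanS/elementaryS => //; apply/op_spanS/power_tailS.
have [k hk] : exists k, E k 1%N Y.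
  elim: (odot_op_span hY) => [|a U U' [F [G [BF NG hU]]] _ [k' hU']].
    by exists 0%N; exact: op_span0.
  have [k hG] := frakN_power_tail NG; exists (maxn k k'); apply: op_span_lin.
    apply: (mono _ _ (leq_maxl _ _)); apply: op_span_in.
    by exists F, G; split=> //; exact: bB.
  exact: mono (leq_maxr _ _) _ hU'.
have [p Mp] := Mnil k.
have iterE q : E k q.+1 (iter q.+1 Y).
  elim: q => [|q ih] //.
  rewrite (_ : iter q.+2 Y = Y \o iter q.+1 Y) //.
  apply: op_span_comp hk ih; first by move=> U; exact: elementary_bounded.
  apply: elementary_comp; first by move=> F F'; exact: bounded_comp.
  by move=> G G'; exact: power_span_comp.
exists p.+1 => x; suff -> : iter p.+1 Y = 0 by [].
apply: (op_span_sub (B := [set 0]) _ _ _ (iterE p)) => //= [a T U -> ->|U].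
  by rewrite scaler0 addr0.
move=> [F [G [_ hG hU]]].
have G0 : G = 0.
  apply: (op_span_sub (B := [set 0]) _ _ _ hG) => //= [a T U' -> ->|T].
    by rewrite scaler0 addr0.
  apply: power_tail_nilpotent => y /=; rewrite Mp.
  exact: lin0 (proj1 (M_bounded k)).
apply: (tensor2_op_uniq tt hU); split; first exact: bounded0.
by move=> y z; rewrite G0 (tensor2_0r tt).
Qed.

End Nilpotent.

(** * The dense subalgebra of the minimal tensor product *)

Lemma C0_01M (R : realType) (f g : R -> R[i]) :
  C0_01 f -> C0_01 g -> C0_01 (fun x => f x * g x).
Proof.
move=> [cf f0] [cg g0]; split.
  by move=> x; apply: (@cvgM R[i]^o); [exact: cf|exact: cg].
by rewrite -(mulr0 (0 : R[i])); apply: (@cvgM R[i]^o).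
Qed.

Theorem lemma4p9 (R : realType) (H : nat -> hilbertType R)
    (A M : forall n, H n -> H n) (xi : forall n, H n)
    (H_fin : forall n, finite_dimensional (H n))
    (A_pos : forall n, positive_op (A n))
    (A_norm : forall n, opnorm (A n) = 1)
    (M_bounded : forall n, bounded_op (M n))
    (M_nilpotent : forall n, nilpotent_op (M n))
    (AM_summable : cvgn (series (fun n => opnorm (A n - M n))))
    (xi_unit : forall n, `|xi n| = 1)
    (A_xi : forall n, A n (xi n) = xi n)
    (* K, the infinite tensor product of the H n *)
    (X : infinite_tensor xi)
    (* a faithful representation of C_0(0,1] on L, and the tensor product P of
       L and K, on which C_0(0,1] (x)_min frakC acts *)
    (L : hilbertType R) (rho : (R -> R[i]) -> L -> L)
    (rho_rep : C0_01_faithful_rep rho)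
    (P : hilbertType R) (t : L -> lim_tensor X -> P) (t_tensor : is_tensor2 t) :
  let CC := min_tensor t (rho @` C0_01) (frakC X A) in
  let CN := odot t (rho @` C0_01) (frakN X M) in
  [/\ subalgebra CN, CN `<=` CC, CC `<=` norm_closure CN
    & forall Y, CN Y -> nilpotent_op Y].

Proof.
move=> CC CN.
have A_bounded n : bounded_op (A n) := proj1 (A_pos n).
have nM : summably_close A M.
  split=> //; rewrite (_ : (fun n => _) = (fun n => opnorm (A n - M n))) //.
  by apply/funext => n; rewrite opnormBC.
have [rho_b _ rhoM _ _] := rho_rep.
have bB F : (rho @` C0_01) F -> bounded_op F by move=> [f hf <-]; exact: rho_b.
have compB F F' : (rho @` C0_01) F -> (rho @` C0_01) F' -> (rho @` C0_01) (F \o F').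
  move=> [f hf <-] [g hg <-]; rewrite -rhoM //.
  by exists (fun x => f x * g x) => //; exact: C0_01M.
have sN := frakN_subalgebra X M.
have sCN := odot_subalgebra t_tensor compB sN.
have [bCN _ _ _] := sCN.
have NC : frakN X M `<=` frakC X A.
  exact: (frakN_sub_frakC xi_unit A_bounded A_norm A_xi nM).
have CNcl : frakC X A `<=` norm_closure (frakN X M).
  apply: (frakC_sub_closure xi_unit H_fin A_bounded A_norm A_xi _ nM).
  by move=> n; apply: positive_selfadjoint.
have [[bC _ _ _] _ _] := frakC_cstar X A.
split=> //.
- apply: (subset_trans (odotS NC)); apply: sub_norm_closure => T /odot_op_span.
  by apply: op_span_bounded => U; exact: elementary_bounded.
- apply: (subset_trans _ (norm_closure_idem bCN)).
  exact/norm_closureS/odot_approx.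
- exact: (odot_nilpotent xi_unit M_bounded A_bounded A_norm nM t_tensor M_nilpotent bB).
Qed.
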